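(* Assume the standing hypotheses described in the context. Take $0\le\theta\le\Theta$ and $N_\theta\in\mathcal N_\theta$. For any $(t_0,\varepsilon_0)\in\Omega$ and $y_0\in K(t_0,\varepsilon_0)$, the sequences \[y_{k+1}=N_\theta(y_k),\qquad (t_{k+1},\varepsilon_{k+1})=n_\theta(t_k,\varepsilon_k),\qquad k=0,1,\dots,\] are well defined, $y_k\in K(t_k,\varepsilon_k)$ and $(t_k,\varepsilon_k)\in\Omega$ for all $k$, the sequence $\{t_k\}$ is strictly increasing and converges to some $\tilde t\in(0,\lambda]$, the sequence $\{\varepsilon_k\}$ is non-decreasing and converges to some $\tilde\varepsilon\in[0,\kappa\lambda]$, \[\|F'(x_0)^{-1}F(y_k)\|\le f(t_k)+\varepsilon_k\le\Big(\frac{1+\theta^2}{2}\Big)^k(f(t_0)+\varepsilon_0),\qquad k=0,1,\dots,\] the sequence $\{y_k\}$ is contained in $B(x_0,\lambda)$ and converges to a point $x_*\in B[x_0,t_*]$ which is the unique zero of $F$ in $B(x_0,\bar\tau)$, and \[\|y_{k+1}-y_k\|\le t_{k+1}-t_k,\qquad \|x_*-y_k\|\le\tilde t-t_k,\qquad k=0,1,\dots.\] Moreover, if $\lambda<R$, then for $k=0,1,\dots$, \[\|x_*-y_{k+1}\|\le\Big[\frac{1+\theta}{2}\frac{D^-f'(\lambda)}{|f'(\lambda)|}\|x_*-y_k\|+\theta\,\frac{2+f'(\lambda)}{|f'(\lambda)|}\Big]\|x_*-y_k\|,\] and if additionally $0\le\theta<\kappa/(4+\kappa)$, then $\|x_*-y_{k+1}\|\le\big[\frac{1+\theta}{2}+\frac{2\theta}{\kappa}\big]\|x_*-y_k\|$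 for $k=0,1,\dots$.
   Context: Standing hypotheses: $\mathbb X,\mathbb Y$ are Banach spaces; $B(x,r)$, $B[x,r]$ are open/closed balls. $R\in\mathbb R$, $C\subseteq\mathbb X$, $F:C\to\mathbb Y$ is continuous and continuously differentiable on $\mathrm{int}(C)$, $x_0\in\mathrm{int}(C)$ with $F'(x_0)$ non-singular, $f:[0,R)\to\mathbb R$ is continuously differentiable, $B(x_0,R)\subseteq C$, $\|F'(x_0)^{-1}[F'(y)-F'(x)]\|\le f'(\|y-x\|+\|x-x_0\|)-f'(\|x-x_0\|)$ for all $x,y\in B(x_0,R)$ with $\|x-x_0\|+\|y-x\|<R$, $\|F'(x_0)^{-1}F(x_0)\|\le f(0)$, and (h1) $f(0)>0$, $f'(0)=-1$; (h2) $f'$ is strictly increasing and convex; (h3) $f(t)<0$ for some $t\in(0,R)$. Notation: $t_*:=\min f^{-1}(\{0\})$, $\bar\tau:=\sup\{t\in[0,R):f(t)<0\}$, $\bar t:=\sup\{t\in[0,R):f'(t)<0\}$, $\kappa:=\sup_{0<t<R}\frac{-f(t)}{t}$, $\lambda:=\sup\{t\in[0,R):\kappa+f'(t)<0\}$, $\Theta:=\kappa/(2-\kappa)$. $D^-f'(\lambda)$ is the left derivative of $f'$ at $\lambda$. For $\theta\ge0$, $n_\theta:[0,\bar t)\times[0,\infty)\to\mathbb R^2$, $n_\theta(t,\varepsilon):=\big(t-(1+\theta)\frac{f(t)+\varepsilon}{f'(t)},\ \varepsilon+2\theta(f(t)+\varepsilon)\big)$. $\Omega:=\{(t,\varepsilon)\in\mathbb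 R^2: 0\le t<\lambda,\ 0\le\varepsilon\le\kappa t,\ 0<f(t)+\varepsilon\}$. $K(t,\varepsilon):=\{x: \|x-x_0\|\le t,\ \|F'(x_0)^{-1}F(x)\|\le f(t)+\varepsilon\}$. $\mathcal N_\theta$ is the family of maps $N:B(x_0,\bar t)\to\mathbb X$ such that $\|F'(x_0)^{-1}[F(x)+F'(x)(N(x)-x)]\|\le\theta\|F'(x_0)^{-1}F(x)\|$ for each $x\in B(x_0,\bar t)$. *)

(* Defs.v *)
From HB Require Import structures.
From mathcomp Require Import all_boot all_order all_algebra.
From mathcomp Require Import all_classical all_reals all_analysis.
Set Implicit Arguments. Unset Strict Implicit. Unset Printing Implicit Defensive.
Import Order.TTheory GRing.Theory Num.Theory.
Import numFieldNormedType.Exports.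
Local Open Scope classical_set_scope.
Local Open Scope ring_scope.

Section Defs.
Variable R : realType.
Implicit Types (f fd : R -> R) (Rr t e theta : R).

(* t_* := min f^{-1}({0})  (f is defined on [0,R)) *)
Definition tstar f Rr : R := inf [set t | 0 <= t < Rr /\ f t = 0].
Definition taubar f Rr : R := sup [set t | 0 <= t < Rr /\ f t < 0].
Definition tbar fd Rr : R := sup [set t | 0 <= t < Rr /\ fd t < 0].
Definition kappa f Rr : R :=
  sup [set y | exists t, 0 < t < Rr /\ y = - f t / t].
Definition lambda f fd Rr : R :=
  sup [set t | 0 <= t < Rr /\ kappa f Rr + fd t < 0].
Definition Theta f Rr : R := kappa f Rr / (2 - kappa f Rr).

Definition Dminus (g : R -> R) (a : R) : R :=
  lim ((fun h => (g a - g (a - h)) / h) @ 0^'+).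

Definition n_theta f fd theta (p : R * R) : R * R :=
  (p.1 - (1 + theta) * (f p.1 + p.2) / fd p.1,
   p.2 + 2 * theta * (f p.1 + p.2)).

Definition Omega f fd Rr (p : R * R) : Prop :=
  0 <= p.1 < lambda f fd Rr /\ 0 <= p.2 <= kappa f Rr * p.1 /\ 0 < f p.1 + p.2.

End Defs.

(* K(t, eps), with Ainv = F'(x0)^{-1} *)
Definition Kset (R : realType) (X Y : normedModType R) (F : X -> Y)
  (Ainv : Y -> X) (x0 : X) (f : R -> R) (t e : R) (x : X) : Prop :=
  `|x - x0| <= t /\ `|Ainv (F x)| <= f t + e.

(* Main.v *)
(** The iteration is dominated by the scalar one.  Convexity of [f'] controls the
    linearization error of [F] at distance [t] from [x0] by that of [f] at [t], and
    [|F'(x0)^-1 F'(x) v| >= - f'(t) |v|], so [n_theta] carries [K(t, e)] to itself.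
    Invariance of [Omega] and the contraction of [f(t) + e] come from
    [0 <= f(t) + kappa t <= (- f'(t) - kappa) (lambda - t)] on [[0, lambda)] and
    [2 theta <= kappa (1 + theta)].  The quantity [kappa t_k - e_k] is nondecreasing,
    eventually positive and at most [lambda - t_k], whence [lim t_k < lambda] and the
    limit of [y_k] is a zero of [F] inside the domain.  Existence of a zero in
    [B[x0, t_*]] and its uniqueness in [B(x0, taubar)] follow from the simplified Newton
    map [x - F'(x0)^-1 F(x)], dominated by [a + f(a)]: its orbit from [x0] is dominated
    by the scalar orbit from 0, and its distance to any zero by the difference with the
    scalar orbit started where [f < 0]. *)
Require Import Defs.
From HB Require Import structures.
From mathcomp Require Import all_boot all_order all_algebra.
From mathcomp Require Import all_classical all_reals all_analysis.
From mathcomp Require Import ring lra.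
Import Order.TTheory GRing.Theory Num.Theory.
Import numFieldNormedType.Exports.
Local Open Scope classical_set_scope.
Local Open Scope ring_scope.
Set Implicit Arguments. Unset Strict Implicit. Unset Printing Implicit Defensive.

(** The leading [0] makes every term, the first one included, a right operand of the flattened sum,
    so that [addrAC] can move it. *)
Lemma eq_of_add0B (V : zmodType) (x y : V) : 0 + x - y = 0 -> x = y.
Proof. by rewrite add0r => /eqP; rewrite subr_eq0 => /eqP. Qed.

(* Cancels opposite terms of a signed sum in a zmodType. *)
Ltac zmod_eq :=
  apply: eq_of_add0B; rewrite ?(opprD, opprK, oppr0) ?addrA ?addr0;
  repeat match goal with
  | |- context [ - ?x ] =>
      repeat (progress rewrite (addrAC _ (- x) _));
      repeat (progress rewrite (addrAC _ x _)); first [rewrite subrK | rewrite addrK]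
  end; rewrite ?addr0; try reflexivity.

(** * Derivatives relative to an interval and a mean value inequality *)

Section DerivWithin.
Context {R : realType} {V : normedModType R}.
Implicit Types (phi : R -> V) (psi : R -> R) (a b c : R).

(* One-sided at the endpoints of [a, b], as needed for [f] at 0. *)
Definition deriv_within (a b : R) (phi : R -> V) (c : R) (l : V) :=
  forall eps, 0 < eps -> exists2 d, 0 < d &
    forall u, a <= u <= b -> `|u - c| < d ->
      `|phi u - phi c - (u - c) *: l| <= eps * `|u - c|.

Lemma deriv_within_sub phi a b a' b' c l :
  a <= a' -> b' <= b -> deriv_within a b phi c l -> deriv_within a' b' phi c l.
Proof.
move=> aa' bb' dphi eps eps0; have [d d0 hd] := dphi _ eps0.
by exists d => // u /andP[au ub]; apply: hd; rewrite (le_trans aa' au) (le_trans ub bb').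
Qed.

Lemma deriv_withinD phi1 phi2 a b c l1 l2 :
  deriv_within a b phi1 c l1 -> deriv_within a b phi2 c l2 ->
  deriv_within a b (fun t => phi1 t + phi2 t) c (l1 + l2).
Proof.
move=> dphi1 dphi2 eps eps0.
have eps20 : 0 < eps / 2 by rewrite divr_gt0.
have [d1 d10 h1] := dphi1 _ eps20; have [d2 d20 h2] := dphi2 _ eps20.
exists (Num.min d1 d2) => [|u uab]; first by rewrite lt_min d10.
rewrite lt_min => /andP[ud1 ud2].
have -> : phi1 u + phi2 u - (phi1 c + phi2 c) - (u - c) *: (l1 + l2) =
  (phi1 u - phi1 c - (u - c) *: l1) + (phi2 u - phi2 c - (u - c) *: l2).
  by rewrite scalerDr; zmod_eq.
rewrite (splitr eps) mulrDl.
by rewrite (le_trans (ler_normD _ _))// lerD ?h1 ?h2.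
Qed.

Lemma deriv_within_linear (v w : V) a b c :
  deriv_within a b (fun t => t *: v + w) c v.
Proof.
move=> eps eps0; exists 1 => // u _ _.
have -> : u *: v + w - (c *: v + w) - (u - c) *: v = 0.
  by rewrite scalerBl; zmod_eq.
by rewrite normr0 mulr_ge0// ltW.
Qed.

Lemma is_derive_within phi a b c l :
  is_derive c 1 phi l -> deriv_within a b phi c l.
Proof.
move=> [/= dphi <-] eps eps0.
have /cvgrPdist_le/(_ _ eps0) := dphi.
move=> [d /= d0 hd].
exists d => // u _ ucd.
have [->|uc] := eqVneq u c; first by rewrite !subrr scale0r subrr !normr0 mulr0.
have uc0 : u - c != 0 by rewrite subr_eq0.
have := hd (u - c); rewrite /ball /= sub0r normrN => /(_ ucd uc0).
rewrite scaler1 subrK -/(derive _ _ _) => h.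
rewrite distrC -(@ler_pM2l _ `|u - c|^-1) ?invr_gt0 ?normr_gt0//.
rewrite [leRHS]mulrCA mulVf ?normr_eq0// mulr1.
rewrite -normfV -normrZ scalerBr scalerA mulVf// scale1r.
exact: h.
Qed.

(** Stands in for integrating the bound on [dphi]. With a slack [eta] per unit length, the points up
    to which the bound holds have a supremum [c], and differentiability at [c] carries the bound
    past it unless [c = b]. The hypothesis on [psi] is [deriv_within] with the product of [R] as
    scaling. *)
Lemma mean_value_within phi psi dphi dpsi a b : a <= b ->
  (forall c, a <= c <= b -> deriv_within a b phi c (dphi c)) ->
  (forall c, a <= c <= b -> forall eps, 0 < eps -> exists2 d, 0 < d &
    forall u, a <= u <= b -> `|u - c| < d ->
      `|psi u - psi c - (u - c) * dpsi c| <= eps * `|u - c|) ->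
  (forall c, a <= c <= b -> `|dphi c| <= dpsi c) ->
  `|phi b - phi a| <= psi b - psi a.
Proof.
move=> ab dphiP dpsiP dle; apply/ler_addgt0Pr => eps eps0.
have [->|neab] := eqVneq a b; first by rewrite !subrr normr0 add0r ltW.
have ltab : a < b by rewrite lt_neqAle neab.
pose eta := eps / (b - a).
have eta0 : 0 < eta by rewrite divr_gt0// subr_gt0.
suff : `|phi b - phi a| <= psi b - psi a + eta * (b - a).
  by rewrite /eta divfK// subr_eq0 eq_sym.
(* A derivative controls the increments over the intervals straddling [c]. *)
have straddle c : a <= c <= b -> exists2 d, 0 < d & forall s u,
    a <= s -> s <= c -> c <= u -> u <= b -> u - s < d ->
    `|phi u - phi s| <= psi u - psi s + eta * (u - s).
  move=> cab; have eta20 : 0 < eta / 2 by rewrite divr_gt0.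
  have [d1 d10 h1] := dphiP _ cab _ eta20.
  have [d2 d20 h2] := dpsiP _ cab _ eta20.
  exists (Num.min d1 d2) => [|s u as_ sc cu ub]; first by rewrite lt_min d10.
  rewrite lt_min => /andP[usd1 usd2].
  have sab : a <= s <= b by rewrite as_ (le_trans sc)// (le_trans cu).
  have uab : a <= u <= b by rewrite ub (le_trans as_)// (le_trans sc).
  have nu : `|u - c| = u - c by rewrite ger0_norm// subr_ge0.
  have ns : `|s - c| = c - s by rewrite ler0_norm ?opprB// subr_le0.
  have := h1 u uab; have := h1 s sab; have := h2 u uab; have := h2 s sab.
  rewrite nu ns.
  move=> /(_ ltac:(lra)) p1 /(_ ltac:(lra)) p2 /(_ ltac:(lra)) q1 /(_ ltac:(lra)) q2.
  have dc := dle _ cab.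
  have -> : phi u - phi s = (phi u - phi c - (u - c) *: dphi c)
      - (phi s - phi c - (s - c) *: dphi c) + (u - s) *: dphi c.
    by rewrite !scalerBl; zmod_eq.
  have us0 : 0 <= u - s by lra.
  have := ler_normD (phi u - phi c - (u - c) *: dphi c
    - (phi s - phi c - (s - c) *: dphi c)) ((u - s) *: dphi c).
  have := ler_normB (phi u - phi c - (u - c) *: dphi c)
    (phi s - phi c - (s - c) *: dphi c).
  rewrite normrZ (ger0_norm us0).
  have : (u - s) * `|dphi c| <= (u - s) * dpsi c by exact: ler_wpM2l.
  move: p1 p2; rewrite !ler_norml => /andP[? ?] /andP[? ?] *; lra.
pose A := [set s | a <= s <= b /\
  `|phi s - phi a| <= psi s - psi a + eta * (s - a)].
have Aa : A a by rewrite /A /= lexx ab !subrr normr0 mulr0 addr0.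
have Aub : has_ubound A by exists b => s [/andP[]].
have supA : has_sup A by split => //; exists a.
pose c := sup A.
have ac : a <= c by apply: ub_le_sup.
have cb : c <= b by apply: ge_sup; [exists a|move=> s [/andP[]]].
have [|d d0 hd] := straddle c; first by rewrite ac.
(* A point of [A] less than [d / 2] to the left of [c], and any [u] less than [d / 2] to its right,
   lie within reach of [straddle]. *)
have [s As sc] := sup_adherent (divr_gt0 d0 (ltr0n R 2)) supA.
have sc' : s <= c by apply: ub_le_sup.
have cont u : c <= u -> u <= b -> u < c + d / 2 -> A u.
  move=> cu ub ucd; case: As => /andP[as_ sb] hs.
  split; first by rewrite ub (le_trans ac).
  have usd : u - s < d by rewrite -/c in sc; lra.
  have := hd s u as_ sc' cu ub usd.
  have := ler_normD (phi u - phi s) (phi s - phi a); rewrite subrKA; lra.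
have [cltb|] := ltP c b; last first.
  move=> bc; have Ab : A b by apply: cont => //; lra.
  by case: Ab.
pose u := Num.min b (c + d / 4).
have Au : A u.
  apply: cont; rewrite /u ?ge_min ?lexx// ?le_min ?gt_min ?lt_min.
    by apply/andP; split; lra.
  by apply/orP; right; lra.
have : u <= c by apply: ub_le_sup.
by rewrite /u ge_min => /orP[|]; lra.
Qed.

End DerivWithin.

(** Telescoping bounds the distance of two terms of [y] by the difference of those of [t]: [y] is
    Cauchy because [t] converges, and the error bound is the limit of these inequalities. *)
Lemma majorized_cvg {R : realType} (V : completeNormedModType R)
    (y : nat -> V) (t : nat -> R) (l : R) :
  (forall k, `|y k.+1 - y k| <= t k.+1 - t k) -> t @ \oo --> l ->
  exists2 x, y @ \oo --> x & forall k, `|x - y k| <= l - t k.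
Proof.
move=> yt tl.
have dist k m : `|y (m + k)%N - y k| <= t (m + k)%N - t k.
  elim: m => [|m IH]; first by rewrite add0n !subrr normr0.
  have := ler_normD (y (m.+1 + k)%N - y (m + k)%N) (y (m + k)%N - y k).
  rewrite subrKA; have := yt (m + k)%N; rewrite addSn; lra.
have cy : cvg (y @ \oo).
  apply/cauchy_cvgP; apply: cauchy_exP => eps eps0.
  have eps20 : 0 < eps / 2 by rewrite divr_gt0.
  have /cvgrPdist_lt/(_ _ eps20)[n _ hn] := tl.
  exists (y n); exists n => // m /= nm.
  rewrite -ball_normE /= distrC -(subnK nm) (le_lt_trans (dist n (m - n)%N))//.
  rewrite subnK//; have := hn n (leqnn n); have := hn m nm; rewrite /= !ltr_norml.
  by move=> /andP[? ?] /andP[? ?]; lra.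
exists (lim (y @ \oo)) => // k.
have c1 : (fun n => `|y n - y k|) @ \oo --> `|lim (y @ \oo) - y k|.
  by apply: cvg_norm; apply: cvgB => //; exact: cvg_cst.
have c2 : (fun n => t n - t k) @ \oo --> l - t k.
  by apply: cvgB => //; exact: cvg_cst.
apply: (ler_cvg_to c1 c2); exists k => // n /= kn.
by have := dist k (n - k)%N; rewrite subnK.
Qed.

Lemma nondecreasing_bounded_cvg {R : realType} (t : nat -> R) (b : R) :
  (forall k, t k <= t k.+1) -> (forall k, t k <= b) ->
  exists2 l, t @ \oo --> l & l <= b /\ forall k, t k <= l.
Proof.
move=> tS tb.
have homo : {homo t : n m / (n <= m)%N >-> n <= m} by exact/nondecreasing_seqP.
have ct : cvgn t by apply: nondecreasing_is_cvgn => //; exists b => _ [k _ <-].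
exists (limn t) => //; split; first by apply: limr_le => //; apply: nearW.
by move=> k; apply: nondecreasing_cvgn_le.
Qed.

(** * Calculus and convexity of the majorant function *)

Section Majorant.
Context {R : realType} (Rr : R) (f fd : R -> R).
Hypothesis hfd : forall t, 0 < t < Rr -> is_derive t 1 f (fd t).
Hypothesis hfd0 : (fun h => (f h - f 0) / h) @ 0^'+ --> fd 0.
Hypothesis h1a : 0 < f 0.
Hypothesis h1b : fd 0 = -1.
Hypothesis h2inc : forall a b, 0 <= a -> a < b -> b < Rr -> fd a < fd b.
Hypothesis h2cvx : forall a b s, 0 <= a < Rr -> 0 <= b < Rr -> 0 <= s <= 1 ->
  fd (s * a + (1 - s) * b) <= s * fd a + (1 - s) * fd b.
Hypothesis h3 : exists t, 0 < t < Rr /\ f t < 0.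

Local Notation K := (kappa f Rr).
Local Notation L := (lambda f fd Rr).

Lemma radius_gt0 : 0 < Rr.
Proof. by have [t [/andP[t0 tR] _]] := h3; exact: lt_trans tR. Qed.

Lemma f_within b c : 0 <= c <= b -> b < Rr ->
  deriv_within 0 b (f : R -> R^o) c (fd c).
Proof.
move=> /andP[c0 cb] bR; have := c0; rewrite le_eqVlt => /predU1P[<-|c_gt0].
  move=> eps eps0; have /cvgrPdist_le/(_ _ eps0)[d /= d0 hd] := hfd0.
  exists d => // u /andP[u0 _] ud.
  have := u0; rewrite le_eqVlt => /predU1P[<-|u_gt0].
    by rewrite !subrr scale0r subrr !normr0 mulr0.
  have := hd u; rewrite /ball /= distrC => /(_ ud u_gt0).
  move=> h; rewrite subr0.
  have -> : f u - f 0 - u *: (fd 0 : R^o) = ((f u - f 0) / u - fd 0) * u.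
    by rewrite mulrBl divfK ?gt_eqF// mulrC.
  by rewrite normrM ler_wpM2r// distrC.
by apply: is_derive_within; apply: hfd; rewrite c_gt0 (le_lt_trans cb).
Qed.

Lemma f_continuous t : 0 < t < Rr -> {for t, continuous f}.
Proof.
move=> tR; apply: differentiable_continuous; apply/derivable1_diffP.
by have [] := hfd tR.
Qed.

Lemma f_right0 : f @ 0^'+ --> f 0.
Proof.
have idc : (fun h : R => h) @ 0^'+ --> (0 : R) by apply: cvg_at_right_filter; exact: cvg_id.
have lim : (fun h => (f h - f 0) / h * h + f 0) @ 0^'+ --> f 0.
  by have := cvgD (cvgM hfd0 idc) (cvg_cst (f 0)); rewrite mulr0 add0r; exact.
suff ev : \forall h \near 0^'+, (f h - f 0) / h * h + f 0 = f h.
  by move: lim; apply: cvg_trans; exact: near_eq_cvg ev.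
near=> h; have h0 : h != 0 by rewrite gt_eqF//; near: h; exact: nbhs_right_gt.
by rewrite divfK// subrK.
Unshelve. all: by end_near. Qed.

Lemma f_mvt a b : 0 <= a -> a < b -> b < Rr ->
  exists2 c, a < c < b & f b - f a = fd c * (b - a).
Proof.
move=> a0 ab bR.
have fin c : c \in `]a, b[ -> 0 < c < Rr.
  by rewrite in_itv /= => /andP[ac cb]; rewrite (le_lt_trans a0)// (lt_trans cb).
have [||c cab fab] := @MVT _ f fd a b ab.
- by move=> c /fin; exact: hfd.
- apply/continuous_within_itvP => //; split.
  + by move=> c /fin; exact: f_continuous.
  + have := a0; rewrite le_eqVlt => /predU1P[<-|a_gt0]; first exact: f_right0.
    by apply: cvg_at_right_filter; apply: f_continuous; rewrite a_gt0 (lt_trans ab).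
  + by apply: cvg_at_left_filter; apply: f_continuous; rewrite bR (le_lt_trans a0).
by exists c => //; move: cab; rewrite in_itv.
Qed.

Lemma f_gt_tangent a b : 0 <= a -> a < b -> b < Rr -> fd a * (b - a) < f b - f a.
Proof.
move=> a0 ab bR; have [c /andP[ac cb] ->] := f_mvt a0 ab bR.
by rewrite ltr_pM2r ?subr_gt0// h2inc// (lt_trans cb).
Qed.

Lemma f_lt_tangent a b : 0 <= a -> a < b -> b < Rr -> f b - f a < fd b * (b - a).
Proof.
move=> a0 ab bR; have [c /andP[ac cb] ->] := f_mvt a0 ab bR.
by rewrite ltr_pM2r ?subr_gt0// h2inc// (le_trans a0)// ltW.
Qed.

Lemma fd_mono a b : 0 <= a -> a <= b -> b < Rr -> fd a <= fd b.
Proof.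
move=> a0; rewrite le_eqVlt => /predU1P[->//|ab] bR.
by apply: ltW; apply: h2inc.
Qed.

Lemma fd_ge_N1 t : 0 <= t < Rr -> -1 <= fd t.
Proof. by move=> /andP[t0 tR]; rewrite -h1b fd_mono. Qed.

(** Convexity as a comparison of slopes from [a], with denominators cleared so that degenerate
    intervals are allowed. *)
Lemma fd_chord a u b : 0 <= a -> a <= u -> u <= b -> b < Rr ->
  (fd u - fd a) * (b - a) <= (fd b - fd a) * (u - a).
Proof.
move=> a0 au ub bR.
have [->|neab] := eqVneq a b.
  by rewrite !subrr mulr0 mul0r.
have ab : 0 < b - a by rewrite subr_gt0 lt_neqAle neab (le_trans au).
pose s := (b - u) / (b - a).
have s01 : 0 <= s <= 1.
  by rewrite /s ler_pdivrMr// ler_pdivlMr// mul0r mul1r; apply/andP; split; lra.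
have sba : s * (b - a) = b - u by rewrite divfK ?gt_eqF.
have := @h2cvx a b s.
rewrite a0 (le_lt_trans au (le_lt_trans ub bR)) (le_trans a0 (le_trans au ub)) bR.
move=> /(_ isT isT s01).
have -> : s * a + (1 - s) * b = u by lra.
rewrite -(ler_pM2r ab) => h.
have e : (s * fd a + (1 - s) * fd b) * (b - a) =
  fd b * (b - a) - (s * (b - a)) * (fd b - fd a) by ring.
by rewrite e sba in h; lra.
Qed.

(** The points [a + h] and [b] cut [[a, b + h]] in complementary ratios; adding the chord bounds at
    both gives the claim. *)
Lemma fd_shift a b h : 0 <= a -> a <= b -> 0 <= h -> b + h < Rr ->
  fd (a + h) - fd a <= fd (b + h) - fd b.
Proof.
move=> a0 ab h0 bhR.
have [e|ne] := eqVneq (b + h - a) 0.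
  have -> : h = 0 by lra.
  by rewrite !addr0 !subrr.
have pos : 0 < b + h - a by rewrite lt_neqAle eq_sym ne; lra.
have c1 : (fd (a + h) - fd a) * (b + h - a) <= (fd (b + h) - fd a) * (a + h - a).
  by apply: fd_chord => //; lra.
have c2 : (fd b - fd a) * (b + h - a) <= (fd (b + h) - fd a) * (b - a).
  by apply: fd_chord => //; lra.
rewrite -(ler_pM2r pos); lra.
Qed.

(** Supplies a quadratic [psi] to [mean_value_within]. The error is exactly [q / 2 * (u - c) ^+ 2];
    dividing by [q + 1] covers [q = 0]. *)
Lemma quad_within (q t c eps : R) : 0 <= q -> 0 < eps -> exists2 d, 0 < d &
  forall u, `|u - c| < d ->
  `|q / 2 * (u - t) ^+ 2 - q / 2 * (c - t) ^+ 2 - (u - c) * (q * (c - t))|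
    <= eps * `|u - c|.
Proof.
move=> q0 eps0; exists (eps / (q + 1)); first by rewrite divr_gt0// ltr_wpDl.
move=> u uc.
have -> : q / 2 * (u - t) ^+ 2 - q / 2 * (c - t) ^+ 2 - (u - c) * (q * (c - t))
   = (q / 2 * (u - c)) * (u - c) by field.
rewrite normrM ler_wpM2r// normrM ger0_norm; last lra.
move: uc; rewrite ltr_pdivlMr; last lra.
have := normr_ge0 (u - c); nra.
Qed.

(** On [[t, s]] the convex function [fd - fd t] lies below its chord, whose integral is the
    right-hand side. *)
Lemma f_quad t s : 0 <= t -> t <= s -> s < Rr ->
  f s - f t - fd t * (s - t) <= (fd s - fd t) * (s - t) / 2.
Proof.
move=> t0; rewrite le_eqVlt => /predU1P[->|ts] sR.
  by rewrite !subrr !mulr0 mul0r subrr.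
pose q := (fd s - fd t) / (s - t).
have st0 : 0 < s - t by rewrite subr_gt0.
have q0 : 0 <= q by rewrite divr_ge0 ?subr_ge0 ?ltW// h2inc.
have qst : q * (s - t) = fd s - fd t by rewrite divfK// gt_eqF.
have mv := @mean_value_within R R^o (fun u => f u + (u *: - fd t + 0))
  (fun u => q / 2 * (u - t) ^+ 2) (fun u => fd u - fd t) (fun u => q * (u - t))
  t s (ltW ts).
suff : `|f s + (s * - fd t + 0) - (f t + (t * - fd t + 0))| <=
    q / 2 * (s - t) ^+ 2 - q / 2 * (t - t) ^+ 2.
  rewrite subrr expr0n mulr0 subr0 expr2 mulrA ler_norml => /andP[_].
  rewrite (mulrAC q) qst; lra.
apply: mv.
- move=> c /andP[tc cs]; apply: deriv_withinD; last exact: deriv_within_linear.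
  apply: (@deriv_within_sub _ _ _ 0 s) => //.
  by apply: f_within => //; rewrite cs (le_trans t0).
- move=> c _ eps eps0; have [d d0 hd] := quad_within t c q0 eps0.
  by exists d => // u _; exact: hd.
- move=> c /andP[tc cs].
  rewrite ger0_norm ?subr_ge0 ?fd_mono//; last exact: le_lt_trans sR.
  by rewrite -(ler_pM2r st0) (mulrAC q) qst fd_chord.
Qed.

(** * The constants kappa and lambda *)

Lemma f_gt_line t : 0 < t < Rr -> f 0 - t < f t.
Proof.
move=> /andP[t0 tR]; have := f_gt_tangent (lexx 0) t0 tR.
rewrite h1b subr0; lra.
Qed.

Lemma kappa_ubound : has_ubound [set y | exists t, 0 < t < Rr /\ y = - f t / t].
Proof.
(* From [f 0 - t < f t] the quotient is below [1 - f 0 / t], hence below its value at [Rr]. This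
   bound also gives [K < 1]. *)
exists (1 - f 0 / Rr) => _ [t [tR ->]].
have := f_gt_line tR; case/andP: tR => t0 tR h.
rewrite ler_pdivrMr// mulrBl mul1r.
suff : f 0 / Rr * t <= f 0 by lra.
by rewrite -mulrA ger_pMr// ler_pdivrMl ?mulr1 ?radius_gt0// ltW.
Qed.

Lemma kappa_has_sup : has_sup [set y | exists t, 0 < t < Rr /\ y = - f t / t].
Proof.
split; last exact: kappa_ubound.
by have [t [tR _]] := h3; exists (- f t / t), t.
Qed.

Lemma kappa_ge t : 0 < t < Rr -> 0 <= f t + K * t.
Proof.
move=> tR; have t0 : 0 < t by case/andP: tR.
suff : - f t / t <= K by rewrite ler_pdivrMr//; lra.
by apply: ub_le_sup; [exact: kappa_ubound|exists t].
Qed.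

Lemma kappa_gt0 : 0 < K.
Proof.
have [t [tR ft]] := h3; have := kappa_ge tR; have /andP[t0 _] := tR.
by move=> h; rewrite -(pmulr_lgt0 _ t0); lra.
Qed.

Lemma kappa_lt1 : K < 1.
Proof.
apply: (@le_lt_trans _ _ (1 - f 0 / Rr)); last first.
  by rewrite ltrBlDr ltrDl divr_gt0// radius_gt0.
apply: ge_sup; first by case: kappa_has_sup.
move=> _ [t [tR ->]].
have := f_gt_line tR; case/andP: tR => t0 tR h.
rewrite ler_pdivrMr// mulrBl mul1r.
suff : f 0 / Rr * t <= f 0 by lra.
by rewrite -mulrA ger_pMr// ler_pdivrMl ?mulr1 ?radius_gt0// ltW.
Qed.

Lemma kappa_approx eta : 0 < eta -> exists2 s, 0 < s < Rr & f s + K * s < eta * s.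
Proof.
move=> eta0; have [_ [s [sR ->]] h] := sup_adherent eta0 kappa_has_sup.
exists s => //; case/andP: sR => s0 _.
by move: h; rewrite ltr_pdivlMr// -/(kappa _ _); lra.
Qed.

Lemma lambda_ubound : has_ubound [set t | 0 <= t < Rr /\ K + fd t < 0].
Proof. by exists Rr => t [/andP[_ /ltW]]. Qed.

Lemma lambda_has_sup : has_sup [set t | 0 <= t < Rr /\ K + fd t < 0].
Proof.
split; last exact: lambda_ubound.
by exists 0; rewrite /= lexx radius_gt0 h1b; split => //; have := kappa_lt1; lra.
Qed.

Lemma lambda_le_radius : L <= Rr.
Proof.
apply: ge_sup; first by case: lambda_has_sup.
by move=> t [/andP[_ /ltW]].
Qed.

Lemma fd_lt_lambda t : 0 <= t < L -> fd t < - K.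
Proof.
move=> /andP[t0 tL].
have [u [/andP[u0 uR] Ku]] := sup_adherent (eps := L - t) ltac:(lra) lambda_has_sup.
rewrite -/(lambda _ _ _) => h.
have := @h2inc t u t0 ltac:(lra) uR; lra.
Qed.

Lemma fd_gt_lambda t : 0 <= t -> L < t -> t < Rr -> 0 <= K + fd t.
Proof.
move=> t0 Lt tR; rewrite leNgt; apply/negP => Kt.
suff : t <= L by lra.
by apply: ub_le_sup; [exact: lambda_ubound|split; rewrite ?t0].
Qed.

Lemma lambda_le_tbar : L <= tbar fd Rr.
Proof.
apply: ge_sup; first by case: lambda_has_sup.
move=> t [tR Kt]; apply: ub_le_sup.
  by exists Rr => u [/andP[_ /ltW]].
by split => //; have := kappa_gt0; lra.
Qed.

(* [inf (f s + K s) / s = 0], and the convex function [f + K id] decreases up to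
   [lambda] and increases afterwards. *)
Lemma gap_le t : 0 <= t < L -> f t + K * t <= (- fd t - K) * (L - t).
Proof.
move=> tL; have fdt := fd_lt_lambda tL; case/andP: tL => t0 tL.
have tR : t < Rr := lt_le_trans tL lambda_le_radius.
apply/ler_addgt0Pr => eps eps0.
have R0 := radius_gt0.
(* The supremum [kappa] need not be attained, so [s] only brings [f s + K * s] below [eps]. *)
have [|s /andP[s0 sR] hs] := @kappa_approx (eps / Rr); first by rewrite divr_gt0.
have {}hs : f s + K * s <= eps.
  apply: (le_trans (ltW hs)).
  by rewrite -mulrA ger_pMr// ler_pdivrMl// mulr1 ltW.
have pos : 0 <= (- fd t - K) * (L - t) by rewrite mulr_ge0; lra.
have [st|ts] := leP s t.
  suff : f t + K * t <= f s + K * s by lra.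
  have := st; rewrite le_eqVlt => /predU1P[->//|st'].
  have := f_lt_tangent (ltW s0) st' tR; nra.
have [sL|Ls] := leP s L.
  have := f_gt_tangent t0 ts sR; nra.
have L0 : 0 < L := le_lt_trans t0 tL.
have [c /andP[Lc cs] fc] := f_mvt (ltW L0) Ls sR.
have := fd_gt_lambda (ltW (lt_trans L0 Lc)) Lc (lt_trans cs sR).
have := f_gt_tangent t0 tL (lt_trans Ls sR); nra.
Qed.

(** Since [lambda] may equal [Rr], where [fd] is not controlled, the chord ends at some
    [w < lambda], where [fd w < - K], and [w] is brought close to [lambda]. *)
Lemma fd_chord_lambda t u : 0 <= t -> t <= u -> u < L ->
  (fd u - fd t) * (L - t) <= (- K - fd t) * (u - t).
Proof.
move=> t0 tu uL.
have LR := lambda_le_radius.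
have A0 : 0 <= fd u - fd t by rewrite subr_ge0 fd_mono// (lt_le_trans uL).
set A := fd u - fd t in A0 *.
apply/ler_addgt0Pr => eps eps0.
(* This distance to [L] makes [A * (L - w)] at most [eps]; the [1] covers [A = 0]. *)
pose w := Num.max u (L - eps / (A + 1)).
have A10 : 0 < A + 1 by lra.
have e0 : 0 < eps / (A + 1) by rewrite divr_gt0.
have wL : w < L by rewrite /w gt_max uL; lra.
have uw : u <= w by rewrite le_max lexx.
have wd : L - eps / (A + 1) <= w by rewrite le_max lexx orbT.
have AL : A * (L - w) <= eps.
  have e1 : eps / (A + 1) * (A + 1) = eps by rewrite divfK ?gt_eqF.
  nra.
have := fd_chord t0 tu uw (lt_le_trans wL LR).
have := @fd_lt_lambda w; rewrite wL (le_trans t0 (le_trans tu uw)) => /(_ isT).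
rewrite -/A; nra.
Qed.

(** The supremum only controls [fd] to the left of [lambda]. Convexity excludes a jump at [lambda]:
    the slope from [u] to [lambda] is at most the slope from [lambda] to some [w] beyond it. *)
Lemma fd_lambda : 0 < L -> L < Rr -> fd L <= - K.
Proof.
move=> L0 LR; apply/ler_addgt0Pr => eps eps0.
pose w := (L + Rr) / 2.
have M0 : 0 < fd w - fd L by rewrite subr_gt0 h2inc// /w; lra.
pose u := Num.max 0 (L - eps * (w - L) / (fd w - fd L)).
have wL : 0 < w - L by rewrite /w; lra.
have e0 : 0 < eps * (w - L) / (fd w - fd L) by rewrite divr_gt0// mulr_gt0.
have uL : u < L by rewrite /u gt_max L0; lra.
have u0 : 0 <= u by rewrite le_max lexx.
have ud : L - eps * (w - L) / (fd w - fd L) <= u by rewrite le_max lexx orbT.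
have h : (fd w - fd L) * (L - u) <= eps * (w - L).
  have e1 : eps * (w - L) / (fd w - fd L) * (fd w - fd L) = eps * (w - L).
    by rewrite divfK ?gt_eqF.
  nra.
have c : (fd L - fd u) * (w - u) <= (fd w - fd u) * (L - u).
  by apply: fd_chord; rewrite ?(ltW uL)//; rewrite /w; lra.
have := @fd_lt_lambda u; rewrite u0 uL => /(_ isT) fu.
have {}c : (fd L - fd u) * (w - L) <= (fd w - fd L) * (L - u) by lra.
have : (fd L - fd u) * (w - L) <= eps * (w - L) by apply: le_trans h.
rewrite ler_pM2r//; lra.
Qed.


Lemma fd_neg_le1 t : 0 <= t < L -> K < - fd t <= 1.
Proof.
move=> tL; have := fd_lt_lambda tL; case/andP: tL => t0 tL.
by have := @fd_ge_N1 t; rewrite t0 (lt_le_trans tL lambda_le_radius) => /(_ isT); lra.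
Qed.

(** * One step of the scalar iteration: invariance of [Omega] and contraction *)

Section RelativeError.
Variable theta : R.
Hypothesis hth : 0 <= theta <= Theta f Rr.

Lemma theta_ge0 : 0 <= theta. Proof. by case/andP: hth. Qed.

(** This is [theta <= Theta] freed of the denominator [2 - K], positive since [K < 1]. *)
Lemma theta_kappa : 2 * theta <= K * (1 + theta).
Proof.
have K1 := kappa_lt1; case/andP: hth => _.
by rewrite /Theta ler_pdivlMr; lra.
Qed.

Lemma theta_lt1 : theta < 1.
Proof. by have := theta_kappa; have := kappa_lt1; have := theta_ge0; nra. Qed.

Local Notation n_th := (n_theta f fd theta).

Lemma n_theta_increment t e : Omega f fd Rr (t, e) ->
  ((n_th (t, e)).1 - t) * - fd t = (1 + theta) * (f t + e).
Proof.
move=> [/= tL _]; have /andP[d0 _] := fd_neg_le1 tL; have := kappa_gt0 => K0.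
have fdn : fd t != 0 by rewrite lt_eqF//; lra.
by field.
Qed.

Lemma n_theta_gt t e : Omega f fd Rr (t, e) -> t < (n_th (t, e)).1.
Proof.
move=> Ote; have := n_theta_increment Ote; case: Ote => /= tL [_ p0].
have /andP[d0 _] := fd_neg_le1 tL; have := kappa_gt0; have := theta_ge0.
set t' := t - _ => ? ? h.
have : 0 < (t' - t) * - fd t by rewrite h; nra.
by rewrite pmulr_lgt0; lra.
Qed.

Lemma Omega_gap t e : Omega f fd Rr (t, e) -> f t + e <= (- fd t - K) * (L - t).
Proof.
by move=> [/= tL [/andP[_ eK] p0]]; have := gap_le tL; lra.
Qed.

(** Write [d = - fd t]. A step reaching [lambda] would, by [Omega_gap] and
    [(1 + theta) * (2 - K) <= 2], force [(2 - K) * d <= 2 * (d - K)], that is [2 <= d], against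
    [d <= 1]. *)
Lemma n_theta_lt_lambda t e : Omega f fd Rr (t, e) -> (n_th (t, e)).1 < L.
Proof.
move=> Ote; have := n_theta_increment Ote; have := Omega_gap Ote.
case: Ote => /= tL [_ p0]; have /andP[d0 d1] := fd_neg_le1 tL.
case/andP: tL => t0 tL; have K0 := kappa_gt0; have K1 := kappa_lt1.
have th2 : (1 + theta) * (2 - K) <= 2 by have := theta_kappa; lra.
set t' := t - _; set p := f t + e in p0 *; set d := - fd t in d0 d1 *.
move=> pgap inc; rewrite ltNge; apply/negP => Lt'.
have h1 : (L - t) * d <= (1 + theta) * p by rewrite -inc ler_wpM2r; lra.
have h2 : (2 - K) * ((L - t) * d) <= (2 - K) * ((1 + theta) * p).
  by rewrite ler_wpM2l//; lra.
have h3' : (1 + theta) * (2 - K) * p <= 2 * p by rewrite ler_wpM2r// ltW.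
have : ((2 - K) * d) * (L - t) <= (2 * (d - K)) * (L - t) by lra.
rewrite ler_pM2r; last lra.
have : 0 < K * (2 - d) by rewrite mulr_gt0//; lra.
lra.
Qed.

Lemma n_theta_snd t e : (n_th (t, e)).2 = e + 2 * theta * (f t + e).
Proof. by []. Qed.

(** [K * t - e] is the slack in the constraint [e <= K * t] of [Omega]; the sign of its change is
    that of [K * (1 + theta) - 2 * theta * - fd t]. *)
Lemma n_theta_gap_eq t e : Omega f fd Rr (t, e) ->
  (K * (n_th (t, e)).1 - (n_th (t, e)).2 - (K * t - e)) * - fd t =
  (K * (1 + theta) - 2 * theta * - fd t) * (f t + e).
Proof.
move=> Ote; rewrite n_theta_snd; have := n_theta_increment Ote.
set t' := (n_th _).1; set p := f t + e; set d := - fd t => inc.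
have -> : (K * t' - (e + 2 * theta * p) - (K * t - e)) * d =
  K * ((t' - t) * d) - 2 * theta * p * d by ring.
by rewrite inc; ring.
Qed.

Lemma n_theta_gap t e : Omega f fd Rr (t, e) ->
  K * t - e <= K * (n_th (t, e)).1 - (n_th (t, e)).2.
Proof.
move=> Ote; have := n_theta_gap_eq Ote; case: Ote => [/= tL [_ p0]].
have /andP[d0 d1] := fd_neg_le1 tL; have K0 := kappa_gt0 => h.
rewrite -subr_ge0 -(pmulr_lge0 _ (lt_trans K0 d0)) h mulr_ge0//; last exact: ltW.
have := theta_kappa; have : 2 * theta * - fd t <= 2 * theta.
  by rewrite ler_piMr//; have := theta_ge0; lra.
lra.
Qed.

(** For [0 < t] one has [- fd t < 1], so the coefficient stays positive even in the extreme case
    [2 * theta = K * (1 + theta)]. *)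
Lemma n_theta_gap_lt t e : Omega f fd Rr (t, e) -> 0 < t ->
  K * t - e < K * (n_th (t, e)).1 - (n_th (t, e)).2.
Proof.
move=> Ote t0; have := n_theta_gap_eq Ote; case: Ote => [/= tL [_ p0]].
have /andP[d0 d1] := fd_neg_le1 tL; have K0 := kappa_gt0 => h.
rewrite -subr_gt0 -(pmulr_lgt0 _ (lt_trans K0 d0)) h mulr_gt0//.
have th0 := theta_ge0; have thK := theta_kappa.
have d1' : - fd t < 1.
  have /andP[_ tL'] := tL.
  by have := h2inc (lexx 0) t0 (lt_le_trans tL' lambda_le_radius); rewrite h1b; lra.
have := th0; rewrite le_eqVlt => /predU1P[<-|th_gt0].
  by rewrite mulr0 mul0r subr0 addr0 mulr1.
have : 2 * theta * - fd t < 2 * theta by rewrite gtr_pMr//; lra.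
lra.
Qed.

(** The scalar step imitates an inexact Newton step: the new residual is the linearization error of
    [f] plus [theta] times the old residual. *)
Lemma n_theta_residual t e : Omega f fd Rr (t, e) ->
  f (n_th (t, e)).1 + (n_th (t, e)).2 =
  f (n_th (t, e)).1 - f t - fd t * ((n_th (t, e)).1 - t) + theta * (f t + e).
Proof.
by move=> Ote; rewrite n_theta_snd; have := n_theta_increment Ote; lra.
Qed.

Lemma Omega_step t e : Omega f fd Rr (t, e) -> Omega f fd Rr (n_th (t, e)).
Proof.
move=> Ote; have tt' := n_theta_gt Ote; have t'L := n_theta_lt_lambda Ote.
have gap := n_theta_gap Ote; have res := n_theta_residual Ote.
have snd := n_theta_snd t e; have th0 := theta_ge0.
case: Ote => [/= /andP[t0 tL] [/andP[e0 eK] p0]].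
have p1 : 0 <= theta * (f t + e) by rewrite mulr_ge0// ltW.
have := f_gt_tangent t0 tt' (lt_le_trans t'L lambda_le_radius).
split; last split.
- by apply/andP; split => //; lra.
- by apply/andP; split; lra.
- by rewrite res; lra.
Qed.

(** By [f_quad] it suffices that [x * del <= (1 - theta) ^+ 2 * p], because [(1 - theta) ^+ 2 / 2 +
    theta = (1 + theta ^+ 2) / 2]. After multiplication by [d ^+ 2 * M] one uses in turn the chord
    bound [x * M <= (d - K) * del], the equation [del * d = (1 + theta) * p] and the gap bound
    [p <= (d - K) * M]. *)
Lemma n_theta_contract t e : Omega f fd Rr (t, e) ->
  f (n_th (t, e)).1 + (n_th (t, e)).2 <= (1 + theta ^+ 2) / 2 * (f t + e).
Proof.
move=> Ote; have tt' := n_theta_gt Ote; have t'L := n_theta_lt_lambda Ote.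
rewrite n_theta_residual//; have := n_theta_increment Ote; have := Omega_gap Ote.
case: Ote => [/= tL [_ p0]]; have /andP[d0 d1] := fd_neg_le1 tL.
case/andP: tL => t0 tL.
have th0 := theta_ge0; have th1 := theta_lt1; have thK := theta_kappa.
have K0 := kappa_gt0.
have := fd_chord_lambda t0 (ltW tt') t'L.
have := f_quad t0 (ltW tt') (lt_le_trans t'L lambda_le_radius).
set t' := (n_th _).1 in tt' t'L *.
change (t - (1 + theta) * (f t + e) / fd t) with t'.
set x := fd t' - fd t; set p := f t + e in p0 *.
have -> : - K - fd t = - fd t - K by rewrite addrC.
set d := - fd t in d0 d1 *; set del := t' - t; set M := L - t.
move=> quad chord pgap inc.
have M0 : 0 < M by rewrite /M; lra.
have del0 : 0 < del by rewrite /del; lra.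
have dpos : 0 < d by lra.
suff : x * del <= (1 - theta) ^+ 2 * p by lra.
have dK0 : 0 <= d - K by lra.
have s1 : x * M * (del * d ^+ 2) <= (d - K) * del * (del * d ^+ 2).
  by rewrite ler_wpM2r// mulr_ge0 ?sqr_ge0 ?ltW.
have s2 : (d - K) * del * (del * d ^+ 2) = ((d - K) * (1 + theta) ^+ 2 * p) * p.
  have -> : (d - K) * del * (del * d ^+ 2) = (d - K) * (del * d) ^+ 2 by ring.
  by rewrite inc; ring.
have s3 : ((d - K) * (1 + theta) ^+ 2 * p) * p <=
    ((d - K) * (1 + theta) ^+ 2 * p) * ((d - K) * M).
  by rewrite ler_wpM2l// mulr_ge0 ?(ltW p0)// mulr_ge0 ?sqr_ge0.
(* Amounts to [2 * theta * d <= K * (1 + theta)], from [theta_kappa] and [d <= 1]. *)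
have s4 : ((d - K) * (1 + theta)) ^+ 2 <= (d * (1 - theta)) ^+ 2.
  rewrite ler_sqr ?nnegrE; last 2 first.
  - by rewrite mulr_ge0//; lra.
  - by rewrite mulr_ge0//; lra.
  have : d * theta <= theta by rewrite ler_piMl.
  lra.
have s5 : ((d - K) * (1 + theta)) ^+ 2 * (p * M) <= (d * (1 - theta)) ^+ 2 * (p * M).
  by rewrite ler_wpM2r// mulr_ge0 ?ltW.
have dM : 0 < d ^+ 2 * M by rewrite mulr_gt0// exprn_gt0.
rewrite -(ler_pM2r dM); lra.
Qed.

(** * The scalar sequences *)

Section Sequence.
Variables (t0 e0 : R).
Hypothesis hOm0 : Omega f fd Rr (t0, e0).
Local Notation te k := (iter k n_th (t0, e0)).

Lemma Omega_iter k : Omega f fd Rr (te k).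
Proof. by elim: k => [//|k]; rewrite iterS; case: (te k) => a b; exact: Omega_step. Qed.

Lemma t_iter_lt k : (te k).1 < (te k.+1).1.
Proof. by have := Omega_iter k; rewrite iterS; case: (te k) => a b; exact: n_theta_gt. Qed.

Lemma e_iter_le k : (te k).2 <= (te k.+1).2.
Proof.
have := Omega_iter k; rewrite iterS; case: (te k) => a b [_ [_ /= p0]].
by rewrite lerDl mulr_ge0 ?mulr_ge0 ?theta_ge0// ltW.
Qed.

Lemma residual_iter_le k :
  f (te k).1 + (te k).2 <= ((1 + theta ^+ 2) / 2) ^+ k * (f t0 + e0).
Proof.
elim: k => [|k IH]; first by rewrite expr0 mul1r.
rewrite exprS -mulrA; apply: (@le_trans _ _ ((1 + theta ^+ 2) / 2 *
  (f (te k).1 + (te k).2))); last first.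
  by rewrite ler_wpM2l// divr_ge0// addr_ge0// sqr_ge0.
by have := Omega_iter k; rewrite iterS; case: (te k) => a b; exact: n_theta_contract.
Qed.

Lemma residual_iter_cvg : (fun k => f (te k).1 + (te k).2) @ \oo --> (0 : R).
Proof.
have th0 := theta_ge0; have th1 := theta_lt1.
have q1 : `|(1 + theta ^+ 2) / 2| < 1.
  rewrite ger0_norm; last by rewrite divr_ge0// addr_ge0// sqr_ge0.
  by rewrite ltr_pdivrMr//; nra.
apply: (@squeeze_cvgr _ _ _ _ (fun=> 0)
  (geometric (f t0 + e0) ((1 + theta ^+ 2) / 2))).
- apply: nearW => k; apply/andP; split.
    by have [_ [_ /ltW]] := Omega_iter k.
  by rewrite /geometric /= mulrC residual_iter_le.
- exact: cvg_cst.
- exact: cvg_geometric.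
Qed.

(* The gap [K t_k - e_k] is nondecreasing and positive from [k = 2] on, and it is
   bounded by [lambda - t_k]: this keeps the limit of [t_k] away from [lambda]. *)
Lemma t_iter_bounded : exists2 b, b < L & forall k, (te k).1 <= b.
Proof.
have gap k : K * (te k).1 - (te k).2 <= K * (te k.+1).1 - (te k.+1).2.
  by have := Omega_iter k; rewrite iterS; case: (te k) => a b; exact: n_theta_gap.
have t1 : 0 < (te 1).1.
  by case: hOm0 => /andP[/= t00 _] _; exact: le_lt_trans (t_iter_lt 0).
(* As [t0] may be [0], the first step only makes [t] positive; the second makes the gap positive. *)
have G2 : 0 < K * (te 2).1 - (te 2).2.
  have := Omega_iter 1; rewrite (iterS 1); move: t1.
  case: (te 1) => a b /= a0 Oab; have := n_theta_gap_lt Oab a0.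
  by case: Oab => /= _ [/andP[_ bK] _]; lra.
exists (L - (K * (te 2).1 - (te 2).2)); first by rewrite ltrBlDr ltrDl.
(* At a point [(a, b)] of [Omega], [K * a - b < f a + K * a], and [gap_le] with [- fd a - K <= 1]
   bounds this by [L - a]. *)
have big k : (te k.+2).1 <= L - (K * (te 2).1 - (te 2).2).
  have : K * (te 2).1 - (te 2).2 <= K * (te k.+2).1 - (te k.+2).2.
    by elim: k => // k IH; apply: le_trans (gap _).
  have := Omega_iter k.+2; move: (te k.+2) (te 2) => [a b] [a2 b2].
  move=> /[dup] Oab [/= aL [_ p0]]; have := gap_le aL.
  have /andP[d0 d1] := fd_neg_le1 aL; have K0 := kappa_gt0.
  have : (- fd a - K) * (L - a) <= L - a.
    by rewrite ler_piMl//; case/andP: aL => *; lra.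
  lra.
case=> [|[|k]]; last exact: big.
- by apply: le_trans (big 0); rewrite ltW// (lt_trans (t_iter_lt _) (t_iter_lt _)).
- by apply: le_trans (big 0); rewrite ltW// t_iter_lt.
Qed.

End Sequence.
End RelativeError.

(** * The simplified Newton map [a + f a] of the majorant, monotone because [-1 <= fd] *)

Lemma simplified_step_le a b : 0 <= a -> a <= b -> b < Rr -> a + f a <= b + f b.
Proof.
move=> a0; rewrite le_eqVlt => /predU1P[->//|ab] bR.
have := f_gt_tangent a0 ab bR; have := @fd_ge_N1 a.
by rewrite a0 (lt_trans ab bR) => /(_ isT) ? ?; nra.
Qed.

Lemma simplified_iter_fixed (s : nat -> R) l : 0 < l < Rr ->
  (forall k, s k.+1 = s k + f (s k)) -> s @ \oo --> l -> f l = 0.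
Proof.
move=> lR sS sl.
have fl : (fun k => f (s k)) @ \oo --> f l.
  exact: (continuous_cvg _ (f_continuous lR) sl).
have sSl : (fun k => s k.+1 - s k) @ \oo --> l - l.
  by apply: cvgB => //; rewrite cvg_shiftS.
rewrite subrr in sSl; apply: (cvg_unique _ fl) => //.
by apply: cvg_trans sSl; refine (near_eq_cvg _); apply: nearW => k; rewrite sS addrC addKr.
Qed.

Local Notation simpl_iter := (fun k => iter k (fun a => a + f a)).

(** Monotonicity keeps the orbit of [0] increasing and below every [b] with [f b <= 0], so its limit
    is the smallest zero of [f]. *)
Lemma simplified_iter_cvg : exists l, [/\ 0 < l < Rr, f l = 0,
  (fun k => simpl_iter k 0) @ \oo --> l,
  (forall k, 0 <= simpl_iter k 0 <= l) &
  forall b, 0 <= b < Rr -> f b <= 0 -> l <= b].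
Proof.
pose s k := simpl_iter k 0.
have sb b : 0 <= b < Rr -> f b <= 0 -> forall k, 0 <= s k <= b /\ s k <= s k.+1.
  move=> /andP[b0 bR] fb; elim=> [|k [/andP[sk0 skb] skS]].
    by rewrite /s /= lexx b0 add0r ltW.
  have sSb : s k.+1 <= b.
    by have := simplified_step_le sk0 skb bR; rewrite /s iterS -/(s k); lra.
  split; first by rewrite sSb (le_trans sk0).
  by rewrite [leLHS]iterS [leRHS]iterS; apply: simplified_step_le => //;
     exact: le_lt_trans bR.
have [b [/andP[b0 bR] fb]] := h3.
have bb : 0 <= b < Rr by rewrite ltW.
have [l sl [lb skl]] := @nondecreasing_bounded_cvg _ s b
  (fun k => (sb b bb (ltW fb) k).2) (fun k => (andP (sb b bb (ltW fb) k).1).2).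
have lR : 0 < l < Rr.
  rewrite (le_lt_trans lb bR) andbT; apply: lt_le_trans (skl 1%N).
  by rewrite /s /= add0r.
exists l; split => //.
- exact: (simplified_iter_fixed lR (s := s)).
- by move=> k; rewrite skl andbT; have [/andP[]] := sb b bb (ltW fb) k.
- move=> c cR fc; apply: (cvgr_to_le sl); apply: nearW => k.
  by have [/andP[]] := sb c cR fc k.
Qed.

(** The orbit of [b] decreases to a zero of [f]. Were this zero larger than [l], the tangent bound
    towards [l] would make [fd] positive there, and the one towards [b] would then make [f b]
    positive. *)
Lemma simplified_iter_cvg_above l b : 0 < l < Rr -> f l = 0 -> l <= b -> b < Rr ->
  f b < 0 -> (fun k => simpl_iter k b) @ \oo --> l /\
  forall k, l <= simpl_iter k b <= b.
Proof.
move=> /andP[l0 lR] fl lb bR fb; pose u k := simpl_iter k b.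
have ub k : l <= u k <= b /\ u k.+1 <= u k.
  elim: k => [|k [/andP[luk ukb] uS]].
    by rewrite /u /= lexx lb; split => //; lra.
  have ukS : l <= u k.+1.
    have := simplified_step_le (ltW l0) luk (le_lt_trans ukb bR).
    by rewrite /u iterS -/(u k) fl addr0.
  split; first by rewrite ukS (le_trans uS).
  rewrite [leLHS]iterS [leRHS]iterS; apply: simplified_step_le => //.
  - exact: le_trans (ltW l0) ukS.
  - exact: le_lt_trans ukb bR.
split; last by move=> k; exact: (ub k).1.
(* Applied to the opposite sequence, so the limit of [u] is [- m0]. *)
have [m0 um [ml mu]] := @nondecreasing_bounded_cvg _ (fun k => - u k) (- l)
  (fun k => ltac:(rewrite lerN2; exact: (ub k).2))
  (fun k => ltac:(rewrite lerN2; by have [/andP[]] := ub k)).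
have {}um : u @ \oo --> - m0.
  apply: cvg_trans (cvgN um); refine (near_eq_cvg _).
  by apply: nearW => k /=; rewrite !fctE opprK.
have lm : l <= - m0 by rewrite lerNr.
have mb : - m0 <= b.
  by apply: (cvgr_to_le um); apply: nearW => k; have [/andP[]] := ub k.
have fm : f (- m0) = 0.
  apply: (simplified_iter_fixed _ _ um) => //.
  by rewrite (lt_le_trans l0 lm) (le_lt_trans mb bR).
suff <- : - m0 = l by [].
apply/eqP; rewrite eq_le lm andbT leNgt; apply/negP => lm'.
have mb' : - m0 < b.
  by rewrite lt_neqAle mb andbT; apply/eqP => mbE; move: fb; rewrite -mbE fm ltxx.
have := f_lt_tangent (ltW l0) lm' (lt_trans mb' bR).
have := f_gt_tangent (ltW (lt_trans l0 lm')) mb' bR.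
rewrite fl fm !sub0r subr0 => h1 h2.
have : 0 < fd (- m0) by rewrite -(pmulr_lgt0 _ (_ : 0 < - m0 - l))//; lra.
move=> h; have : 0 < fd (- m0) * (b - - m0) by rewrite mulr_gt0//; lra.
lra.
Qed.

Lemma f_segment t s c eps : 0 <= t -> t <= s -> s < Rr -> 0 <= c <= 1 -> 0 < eps ->
  exists2 d, 0 < d & forall u, 0 <= u <= 1 -> `|u - c| < d ->
    `|f (t + u * (s - t)) - f (t + c * (s - t))
      - (u - c) * (fd (t + c * (s - t)) * (s - t))| <= eps * `|u - c|.
Proof.
move=> t0 ts sR /andP[c0 c1] eps0; set w := s - t.
have w0 : 0 <= w by rewrite subr_ge0.
have in_seg v : 0 <= v <= 1 -> 0 <= t + v * w <= s.
  move=> /andP[v0 v1]; have := mulr_ge0 v0 w0.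
  by have := ler_piMl w0 v1; rewrite {2}/w => *; apply/andP; split; lra.
have w1 : 0 < w + 1 by lra.
have e'0 : 0 < eps / (w + 1) by rewrite divr_gt0.
have c01 : 0 <= c <= 1 by rewrite c0.
have [d d0 hd] := f_within (in_seg c c01) sR e'0.
exists (d / (w + 1)) => [|u u01 ud]; first by rewrite divr_gt0.
have e : t + u * w - (t + c * w) = (u - c) * w by ring.
have := hd (t + u * w) (in_seg u u01); rewrite e normrM (ger0_norm w0).
move: ud; rewrite ltr_pdivlMr// => ud.
have uw : `|u - c| * w <= `|u - c| * (w + 1) by rewrite ler_wpM2l//; lra.
move=> /(_ (le_lt_trans uw ud)) h.
have -> : (u - c) * (fd (t + c * w) * w) = ((u - c) * w) * fd (t + c * w) by ring.
apply: le_trans h _.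
apply: (@le_trans _ _ (eps / (w + 1) * (`|u - c| * (w + 1)))).
  by rewrite ler_wpM2l// ltW.
rewrite le_eqVlt; apply/orP; left; apply/eqP.
by field; rewrite gt_eqF.
Qed.

(** By convexity the left difference quotients at [lambda] grow as [h] decreases to [0] and are
    bounded by a slope to the right of [lambda]. Hence the limit in [Dminus] exists, as their
    supremum, and is no default value. *)
Lemma slope_le_Dminus t s : 0 <= t -> t < s -> s < L -> L < Rr ->
  (fd s - fd t) / (s - t) <= Dminus fd L.
Proof.
move=> t0 ts sL LR.
have L0 : 0 < L by apply: le_lt_trans t0 (lt_trans ts sL).
pose g h := (fd L - fd (L - h)) / h.
have gP h : h \in `]0, L] -> 0 < h <= L by rewrite in_itv.
have gmono : {in `]0, L] &, {homo g : m n /~ n <= m}}.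
  move=> n m /gP/andP[n0 nL] /gP/andP[m0 mL] mn.
  rewrite /g ler_pdivrMr// mulrAC ler_pdivlMr//.
  have := @fd_chord (L - m) (L - n) L; rewrite !subKr.
  move=> /(_ ltac:(lra) ltac:(lra) ltac:(lra) LR); lra.
pose w := (L + Rr) / 2.
have Lw : L < w by rewrite /w; lra.
have wR : w < Rr by rewrite /w; lra.
have gub : has_ubound [set g x | x in [set` `]0, L]]].
  exists ((fd w - fd L) / (w - L)) => _ [h /gP/andP[h_gt0 hL] <-].
  rewrite /g ler_pdivrMr// mulrAC ler_pdivlMr; last by rewrite subr_gt0.
  have := @fd_chord (L - h) L w; rewrite subKr.
  by move=> /(_ ltac:(lra) ltac:(lra) (ltW Lw) wR); lra.
have gl : g @ 0^'+ --> sup [set g x | x in [set` `]0, L]]].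
  by apply: nonincreasing_at_right_cvgr gmono gub; rewrite bnd_simp.
have -> : Dminus fd L = sup [set g x | x in [set` `]0, L]]].
  by apply: cvg_lim => //; exact: norm_hausdorff.
apply: (@le_trans _ _ (g (L - t))); last first.
  apply: ub_le_sup => //; exists (L - t) => //=.
  by rewrite in_itv /=; apply/andP; split; lra.
rewrite /g subKr ler_pdivrMr; last by rewrite subr_gt0.
rewrite mulrAC ler_pdivlMr; last by rewrite subr_gt0 (lt_trans ts).
by have := fd_chord t0 (ltW ts) (ltW sL) LR.
Qed.

(** * Consequences of the majorant condition in the Banach spaces *)

Section Newton.
Context (X Y : completeNormedModType R).
Variables (C : set X) (F : X -> Y) (x0 : X) (Ainv : Y -> X).
Hypothesis hFd : forall x, interior C x -> differentiable F x.
Hypothesis hA1 : forall v, Ainv ('d F x0 v) = v.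
Hypothesis hA2 : forall w, 'd F x0 (Ainv w) = w.
Hypothesis hAc : continuous Ainv.
Hypothesis hBC : forall x, `|x - x0| < Rr -> C x.
Hypothesis hmaj : forall x y, `|x - x0| < Rr -> `|y - x0| < Rr ->
  `|x - x0| + `|y - x| < Rr ->
  forall v, `|Ainv ('d F y v - 'd F x v)|
    <= (fd (`|y - x| + `|x - x0|) - fd `|x - x0|) * `|v|.
Hypothesis hF0 : `|Ainv (F x0)| <= f 0.

(** Linearity of [Ainv] is inherited from the differential that it inverts. *)
Lemma AinvD u v : Ainv (u + v) = Ainv u + Ainv v.
Proof. by rewrite -{1}(hA2 u) -{1}(hA2 v) -linearD hA1. Qed.

Lemma AinvZ a v : Ainv (a *: v) = a *: Ainv v.
Proof. by rewrite -{1}(hA2 v) -linearZ hA1. Qed.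

Lemma AinvN v : Ainv (- v) = - Ainv v.
Proof. by rewrite -scaleN1r AinvZ scaleN1r. Qed.

Lemma AinvB u v : Ainv (u - v) = Ainv u - Ainv v.
Proof. by rewrite AinvD AinvN. Qed.

Lemma Ainv0 : Ainv 0 = 0.
Proof. by rewrite -(subrr (0 : Y)) AinvB subrr. Qed.

Lemma Ainv_eq0 w : Ainv w = 0 -> w = 0.
Proof. by move=> Aw; rewrite -(hA2 w) Aw linear0. Qed.

Lemma Ainv_bounded : exists2 M, 0 < M & forall w, `|Ainv w| <= M * `|w|.
Proof.
have /cvgrPdist_le/(_ _ ltr01)/nbhs_ballP[d /= d0 hd] : Ainv w @[w --> 0] --> Ainv 0 by exact: hAc.
exists (2 / d) => [|w]; first by rewrite divr_gt0.
have [->|w0] := eqVneq w 0; first by rewrite Ainv0 !normr0 mulr0.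
have nw : 0 < `|w| by rewrite normr_gt0.
pose a := d / 2 / `|w|.
have a0 : 0 < a by rewrite !divr_gt0.
have := hd (a *: w); rewrite -ball_normE /= sub0r normrN normrZ (gtr0_norm a0).
rewrite divfK ?gt_eqF// => /(_ ltac:(lra)).
rewrite Ainv0 sub0r normrN AinvZ normrZ (gtr0_norm a0).
rewrite -ler_pdivlMl// mulr1 /a invf_div mulrC invf_div.
by rewrite mulrC.
Qed.

Lemma interior_ball x : `|x - x0| < Rr -> interior C x.
Proof.
move=> xR; apply/nbhs_ballP; exists (Rr - `|x - x0|); first by rewrite /= subr_gt0.
move=> z; rewrite -ball_normE /= distrC => zx; apply: hBC.
have := ler_normD (z - x) (x - x0); rewrite subrKA; lra.
Qed.

Lemma differentiable_ball x : `|x - x0| < Rr -> differentiable F x.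
Proof. by move=> xR; apply: hFd; exact: interior_ball. Qed.

Lemma differentiable_eps x eps : differentiable F x -> 0 < eps ->
  exists2 d, 0 < d & forall v, `|v| < d ->
    `|F (v + x) - F x - 'd F x v| <= eps * `|v|.
Proof.
move=> /diff_locallyP[_ /eqaddoP/(_ eps)] + eps0 => /(_ eps0)/nbhs_ballP[d /= d0 hd].
exists d => // v vd; have := hd v; rewrite -ball_normE /= sub0r normrN => /(_ vd).
by rewrite !fctE /= opprD addrA.
Qed.

Lemma segment_within x v c : differentiable F (x + c *: v) ->
  deriv_within 0 1 (fun tau => Ainv (F (x + tau *: v))) c
    (Ainv ('d F (x + c *: v) v)).
Proof.
move=> dF eps eps0; have [M M0 hM] := Ainv_bounded.
have v1 : 0 < `|v| + 1 by have := normr_ge0 v; lra.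
have Mv : 0 < M * (`|v| + 1) by rewrite mulr_gt0.
have eta0 : 0 < eps / (M * (`|v| + 1)) by rewrite divr_gt0.
have [d d0 hd] := differentiable_eps dF eta0.
exists (d / (`|v| + 1)) => [|u _]; first by rewrite divr_gt0.
rewrite ltr_pdivlMr// => ud.
have uv : `|u - c| * `|v| <= `|u - c| * (`|v| + 1) by rewrite ler_wpM2l//; lra.
have := hd ((u - c) *: v); rewrite normrZ => /(_ (le_lt_trans uv ud)).
have -> : (u - c) *: v + (x + c *: v) = x + u *: v by rewrite scalerBl; zmod_eq.
rewrite linearZ /= => h.
rewrite -AinvB -AinvZ -AinvB; apply: le_trans (hM _) _.
apply: (@le_trans _ _ (M * (eps / (M * (`|v| + 1)) * (`|u - c| * (`|v| + 1))))).
  by rewrite ler_wpM2l ?(ltW M0)//; apply: le_trans h _; rewrite ler_wpM2l// ltW.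
rewrite le_eqVlt; apply/orP; left; apply/eqP.
by field; rewrite !gt_eqF.
Qed.

(** The majorant condition with base point [x0], where [fd 0 = -1] and [Ainv] cancels the
    differential. *)
Lemma dF_dist x v t : `|x - x0| <= t -> t < Rr ->
  `|Ainv ('d F x v) - v| <= (1 + fd t) * `|v|.
Proof.
move=> xt tR; have xR := le_lt_trans xt tR.
have := @hmaj x0 x; rewrite subrr normr0 add0r addr0 h1b opprK.
move=> /(_ radius_gt0 xR xR v); rewrite AinvB hA1 => /le_trans; apply.
by rewrite ler_wpM2r// addrC lerD2l fd_mono.
Qed.

Lemma dF_lower x v t : `|x - x0| <= t -> t < Rr ->
  - fd t * `|v| <= `|Ainv ('d F x v)|.
Proof.
move=> xt tR; have := dF_dist v xt tR.
have := lerB_dist v (v - Ainv ('d F x v)); rewrite subKr distrC; lra.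
Qed.

Lemma dF_upper x v t : `|x - x0| <= t -> t < Rr ->
  `|Ainv ('d F x v)| <= (2 + fd t) * `|v|.
Proof.
move=> xt tR; have := dF_dist v xt tR.
have := ler_normD (Ainv ('d F x v) - v) v; rewrite subrK; lra.
Qed.

Lemma segment_dist x v t s c : `|x - x0| <= t -> `|v| <= s - t -> 0 <= c <= 1 ->
  `|x + c *: v - x0| <= t + c * (s - t).
Proof.
move=> xt vst /andP[c0 c1].
have := ler_normD (x - x0) (c *: v); rewrite addrAC normrZ (ger0_norm c0).
have := ler_wpM2l c0 vst; lra.
Qed.

Lemma segment_dist_lt x v t s c : `|x - x0| <= t -> `|v| <= s - t -> s < Rr ->
  0 <= c <= 1 -> `|x + c *: v - x0| < Rr.
Proof.
move=> xt vst sR c01; apply: le_lt_trans (segment_dist xt vst c01) _.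
have st : 0 <= s - t by exact: le_trans vst.
case/andP: c01 => _ c1; have := ler_piMl st c1; lra.
Qed.

(** [hmaj] gives an increment of [fd] starting at the norm of [x - x0]; by [fd_shift] it can only
    grow when started at [t]. *)
Lemma segment_dF x v t s c : `|x - x0| <= t -> `|v| <= s - t -> s < Rr ->
  0 <= c <= 1 -> `|Ainv ('d F (x + c *: v) v) - Ainv ('d F x v)|
    <= (fd (t + c * `|v|) - fd t) * `|v|.
Proof.
move=> xt vst sR c01; have xcR := segment_dist_lt xt vst sR c01.
case/andP: c01 => c0 c1.
have cv : c * `|v| <= `|v| by rewrite ler_piMl.
have cv0 : 0 <= c * `|v| by rewrite mulr_ge0.
have := @hmaj x (x + c *: v).
have -> : x + c *: v - x = c *: v by zmod_eq.
rewrite normrZ (ger0_norm c0) => /(_ ltac:(lra) xcR ltac:(lra) v).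
rewrite AinvB => /le_trans; apply; rewrite ler_wpM2r// (addrC (c * _)).
by apply: fd_shift => //; lra.
Qed.

(** Along the segment, [dF_dist] bounds the derivative of [x - Ainv (F x)] by [1 + fd], the
    derivative of [a + f a], times the length. *)
Lemma simplified_lipschitz x y t s : `|x - x0| <= t -> `|y - x| <= s - t -> s < Rr ->
  `|(y - Ainv (F y)) - (x - Ainv (F x))| <= (s + f s) - (t + f t).
Proof.
move=> xt yst sR; set v := y - x in yst.
have t0 : 0 <= t by exact: le_trans xt.
have st : 0 <= s - t by exact: le_trans yst.
pose phi tau := Ainv (F (x + tau *: v)) + (tau *: - v + - x).
pose psi tau := t + tau * (s - t) + f (t + tau * (s - t)).
have := @mean_value_within _ _ phi psi
  (fun tau => Ainv ('d F (x + tau *: v) v) - v)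
  (fun tau => (1 + fd (t + tau * (s - t))) * (s - t)) 0 1 ler01.
have -> : phi 1 - phi 0 = - ((y - Ainv (F y)) - (x - Ainv (F x))).
  by rewrite /phi !scale1r !scale0r addr0 add0r /v (addrC x) subrK; zmod_eq.
have -> : psi 1 - psi 0 = (s + f s) - (t + f t).
  by rewrite /psi mul1r mul0r addr0 (addrC t (s - t)) subrK.
rewrite normrN; apply.
- move=> c c01; apply: deriv_withinD; last exact: deriv_within_linear.
  by apply: segment_within; apply: differentiable_ball; exact: (segment_dist_lt xt yst sR c01).
- move=> c c01 eps eps0.
  have [|d d0 hd] := f_segment t0 _ sR c01 eps0; first by rewrite -subr_ge0.
  exists d => // u u01 /(hd u u01); congr (`|_| <= _); rewrite /psi; ring.
- move=> c c01; have xcR := segment_dist xt yst c01.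
  have st1 : t + c * (s - t) < Rr.
    by case/andP: c01 => _ c1; have := ler_piMl st c1; lra.
  apply: le_trans (dF_dist v xcR st1) _; rewrite ler_wpM2l//.
  have /andP[c0 _] := c01.
  have := @fd_ge_N1 (t + c * (s - t)); rewrite st1 addr_ge0 ?mulr_ge0// => /(_ isT).
  lra.
Qed.

(** Both sides are increments along segments, from [x] to [y] and from [t] to [s], and [segment_dF]
    compares their derivatives. *)
Lemma linearization_f x y t s : `|x - x0| <= t -> `|y - x| <= s - t -> s < Rr ->
  `|Ainv (F y - F x - 'd F x (y - x))| <= f s - f t - fd t * (s - t).
Proof.
move=> xt yst sR; set v := y - x in yst *.
have t0 : 0 <= t by exact: le_trans xt.
have st : 0 <= s - t by exact: le_trans yst.
pose phi tau := Ainv (F (x + tau *: v)) + (tau *: - Ainv ('d F x v) + 0).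
pose psi tau := f (t + tau * (s - t)) - tau * (fd t * (s - t)).
have := @mean_value_within _ _ phi psi
  (fun tau => Ainv ('d F (x + tau *: v) v) - Ainv ('d F x v))
  (fun tau => (fd (t + tau * (s - t)) - fd t) * (s - t)) 0 1 ler01.
have -> : phi 1 - phi 0 = Ainv (F y - F x - 'd F x v).
  rewrite /phi !scale1r !scale0r !addr0 {1}/v (addrC x (y - x)) subrK !AinvB.
  by zmod_eq.
have -> : psi 1 - psi 0 = f s - f t - fd t * (s - t).
  by rewrite /psi !mul1r !mul0r addr0 subr0 (addrC t (s - t)) subrK addrAC.
apply.
- move=> c c01; apply: deriv_withinD; last exact: deriv_within_linear.
  by apply: segment_within; apply: differentiable_ball; exact: (segment_dist_lt xt yst sR c01).
- move=> c c01 eps eps0.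
  have [|d d0 hd] := f_segment t0 _ sR c01 eps0; first by rewrite -subr_ge0.
  exists d => // u u01 /(hd u u01); congr (`|_| <= _); rewrite /psi; ring.
- move=> c c01; apply: le_trans (segment_dF xt yst sR c01) _.
  have /andP[c0 c1] := c01; have cst := ler_wpM2l c0 yst.
  have := ler_piMl st c1; have := mulr_ge0 c0 (normr_ge0 v) => ? ?.
  apply: ler_pM => //.
    by rewrite subr_ge0 fd_mono//; lra.
  by rewrite lerD2r fd_mono//; lra.
Qed.

(** Here the increments of [fd] are replaced with those of its chord over [[t, s]], which makes the
    bound quadratic in the true distance instead of [s - t]. *)
Lemma linearization_quad x y t s : `|x - x0| <= t -> `|y - x| <= s - t -> t < s ->
  s < Rr -> `|Ainv (F y - F x - 'd F x (y - x))|
    <= (fd s - fd t) / (s - t) / 2 * `|y - x| ^+ 2.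
Proof.
move=> xt yst ts sR; set v := y - x in yst *.
have t0 : 0 <= t by exact: le_trans xt.
have st : 0 < s - t by rewrite subr_gt0.
pose q := (fd s - fd t) / (s - t) * `|v| ^+ 2.
have q0 : 0 <= q.
  by rewrite mulr_ge0 ?sqr_ge0// divr_ge0 ?ltW// ?subr_gt0 h2inc.
pose phi tau := Ainv (F (x + tau *: v)) + (tau *: - Ainv ('d F x v) + 0).
have := @mean_value_within _ _ phi (fun tau => q / 2 * (tau - 0) ^+ 2)
  (fun tau => Ainv ('d F (x + tau *: v) v) - Ainv ('d F x v))
  (fun tau => q * (tau - 0)) 0 1 ler01.
have -> : phi 1 - phi 0 = Ainv (F y - F x - 'd F x v).
  rewrite /phi !scale1r !scale0r !addr0 {1}/v (addrC x (y - x)) subrK !AinvB.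
  by zmod_eq.
have -> : q / 2 * (1 - 0) ^+ 2 - q / 2 * (0 - 0) ^+ 2 =
    (fd s - fd t) / (s - t) / 2 * `|v| ^+ 2 by rewrite /q; ring.
apply.
- move=> c c01; apply: deriv_withinD; last exact: deriv_within_linear.
  by apply: segment_within; apply: differentiable_ball; exact: (segment_dist_lt xt yst sR c01).
- move=> c _ eps eps0; have [d d0 hd] := quad_within 0 c q0 eps0.
  by exists d => // u _; exact: hd.
- move=> c c01; apply: le_trans (segment_dF xt yst sR c01) _.
  have /andP[c0 c1] := c01; rewrite subr0.
  have cv : c * `|v| <= `|v| by rewrite ler_piMl.
  have cv0 : 0 <= c * `|v| by rewrite mulr_ge0.
  have := @fd_chord t (t + c * `|v|) s t0 ltac:(lra) ltac:(lra) sR.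
  rewrite (addrC t) addrK => h.
  have -> : q * c = ((fd s - fd t) * (c * `|v|)) / (s - t) * `|v| by rewrite /q; ring.
  by rewrite ler_wpM2r// ler_pdivlMr// addrC.
Qed.

Lemma limit_zero (y : nat -> X) xs (r : nat -> R) : `|xs - x0| < Rr ->
  y @ \oo --> xs -> (forall k, `|Ainv (F (y k))| <= r k) -> r @ \oo --> (0 : R) ->
  F xs = 0.
Proof.
move=> xsR yxs yr r0; apply: Ainv_eq0; apply/eqP; rewrite -normr_le0.
have cF : {for xs, continuous F}.
  exact/differentiable_continuous/differentiable_ball.
have c1 : (fun k => Ainv (F (y k))) @ \oo --> Ainv (F xs).
  have cA : {for F xs, continuous Ainv} by exact: hAc.
  apply: (continuous_cvg _ cA).
  exact: (continuous_cvg _ cF yxs).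
by apply: (ler_cvg_to (cvg_norm c1) r0); apply: nearW.
Qed.

Lemma zero_exists_unique : exists l xs, [/\ 0 < l < Rr, f l = 0,
  (forall b, 0 <= b < Rr -> f b <= 0 -> l <= b), `|xs - x0| <= l & F xs = 0 /\
  forall z b, b < Rr -> f b < 0 -> `|z - x0| <= b -> F z = 0 -> z = xs].
Proof.
have [l [lR fl sl s0l lmin]] := simplified_iter_cvg.
pose s k := iter k (fun a => a + f a) 0.
pose x k := iter k (fun x => x - Ainv (F x)) x0.
have sR k : s k < Rr.
  by have /andP[_ sk] := s0l k; apply: le_lt_trans sk _; case/andP: lR.
have xs_s k : `|x k - x0| <= s k /\ `|x k.+1 - x k| <= s k.+1 - s k.
  elim: k => [|k [xk dk]].
    rewrite /x /s /= subrr normr0 lexx; split => //.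
    by rewrite (addrC x0) addrK normrN subr0 add0r.
  split; last exact: (simplified_lipschitz xk dk (sR k.+1)).
  have := ler_normD (x k.+1 - x k) (x k - x0); rewrite subrKA; lra.
have [xs xxs dxs] := majorized_cvg (fun k => (xs_s k).2) sl.
have xsl : `|xs - x0| <= l by have := dxs 0%N; rewrite /s /= subr0.
have xsR : `|xs - x0| < Rr by apply: le_lt_trans xsl _; case/andP: lR.
exists l, xs; split => //; split.
  (* [Ainv (F (x k))] is the opposite of the increment of the orbit, dominated by that of [s], which
     tends to [0]. *)
  apply: (limit_zero xsR xxs (r := fun k => s k.+1 - s k)).
    move=> k; have := (xs_s k).2.
    by rewrite {1}/x iterS -/(x k) (addrC (x k)) addrK normrN.
  rewrite -(subrr l); apply: cvgB => //.
  by rewrite (@cvg_shiftS R^o).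
move=> z b bR fb zb Fz.
have b0 : 0 <= b by exact: le_trans zb.
have lb : l <= b by apply: lmin; [rewrite b0|exact: ltW].
have [ul luk] := simplified_iter_cvg_above lR fl lb bR fb.
pose u k := iter k (fun a => a + f a) b.
(* A zero [z] is fixed by the simplified map, so the Lipschitz bound propagates; both scalar orbits
   tend to [l]. *)
have zu k : `|z - x k| <= u k - s k.
  elim: k => [|k IH]; first by rewrite /u /s /x /= subr0.
  have := @simplified_lipschitz (x k) z (s k) (u k) (xs_s k).1 IH.
  rewrite Fz Ainv0 subr0; apply.
  by have /andP[_ ub] := luk k; exact: le_lt_trans bR.
apply/eqP; rewrite -subr_eq0 -normr_le0.
have c1 : (fun k => `|z - x k|) @ \oo --> `|z - xs|.
  by apply: cvg_norm; apply: cvgB => //; exact: cvg_cst.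
have c2 : (fun k => u k - s k) @ \oo --> l - l by exact: cvgB.
by rewrite -(subrr l); apply: (ler_cvg_to c1 c2); apply: nearW.
Qed.

(** * Inexact Newton steps and their error *)

Section InexactStep.
Variables (theta : R) (N : X -> X).
Hypothesis hth : 0 <= theta <= Theta f Rr.
Hypothesis hN : forall x, `|x - x0| < tbar fd Rr ->
  `|Ainv (F x + 'd F x (N x - x))| <= theta * `|Ainv (F x)|.

(** The step length comes from [dF_lower] applied to [r - F x]. Then [F (N x)] is the linearization
    error plus [r], and [n_theta_residual] is the sum of the bounds on these two. *)
Lemma newton_step t e x : Omega f fd Rr (t, e) -> Kset F Ainv x0 f t e x ->
  let p := n_theta f fd theta (t, e) in
  `|N x - x| <= p.1 - t /\ Kset F Ainv x0 f p.1 p.2 (N x).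
Proof.
move=> Ote [xt Fx] p.
have tt' : t < p.1 := n_theta_gt hth Ote.
have t'L : p.1 < L := n_theta_lt_lambda hth Ote.
have inc : (p.1 - t) * - fd t = (1 + theta) * (f t + e) := n_theta_increment theta Ote.
have res := n_theta_residual theta Ote; rewrite -/p in res.
have /andP[d0 d1] : K < - fd t <= 1 by apply: fd_neg_le1; case: Ote.
have K0 := kappa_gt0; have /andP[th0 _] := hth.
have t'R : p.1 < Rr := lt_le_trans t'L lambda_le_radius.
have tR := lt_trans tt' t'R.
have := hN (le_lt_trans xt (lt_le_trans (lt_trans tt' t'L) lambda_le_tbar)).
have := ler_wpM2l th0 Fx; set r := F x + _ => thF hr.
have step : `|N x - x| <= p.1 - t.
  have := dF_lower (N x - x) xt tR.
  have := ler_normB (Ainv r) (Ainv (F x)).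
  rewrite -AinvB {1}/r (addrC (F x)) addrK => h1 h2.
  have : `|N x - x| * - fd t <= (p.1 - t) * - fd t by rewrite inc; lra.
  by rewrite ler_pM2r//; lra.
split => //; split.
  by have := ler_normD (N x - x) (x - x0); rewrite subrKA; lra.
have := linearization_f xt step t'R.
have := ler_normD (Ainv (F (N x) - F x - 'd F x (N x - x))) (Ainv r).
rewrite -AinvD.
have -> : F (N x) - F x - 'd F x (N x - x) + r = F (N x) by rewrite /r; zmod_eq.
by rewrite res; lra.
Qed.

(** Since [F z = 0], the differential at [x] sends [z - y] to [- (E + r)]. The bound on [r] involves
    [F x], itself expanded at [z], so [E] is counted [1 + theta] times. *)
Lemma newton_error x y z t s : F z = 0 -> `|x - x0| <= t -> `|z - x| <= s - t ->
  t < s -> s < Rr -> 0 <= theta ->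
  `|Ainv (F x + 'd F x (y - x))| <= theta * `|Ainv (F x)| ->
  - fd t * `|z - y| <= (1 + theta) / 2 * ((fd s - fd t) / (s - t)) * `|z - x| ^+ 2
    + theta * (2 + fd t) * `|z - x|.
Proof.
move=> Fz xt zst ts sR th0; set r := F x + _ => hr.
have tR := lt_trans ts sR.
have := linearization_quad xt zst ts sR; set E := _ - 'd F x (z - x) => hE.
have := dF_lower (z - y) xt tR.
have -> : 'd F x (z - y) = - (E + r).
  have -> : z - y = (z - x) - (y - x) by zmod_eq.
  by rewrite linearB /E /r Fz; zmod_eq.
rewrite AinvN normrN AinvD => h1.
have := ler_normD (Ainv E) (Ainv r).
have hFx : `|Ainv (F x)| <= `|Ainv E| + (2 + fd t) * `|z - x|.
  have -> : F x = - (E + 'd F x (z - x)) by rewrite /E Fz; zmod_eq.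
  rewrite AinvN normrN AinvD; apply: le_trans (ler_normD _ _) _.
  by rewrite lerD2l dF_upper.
have := ler_wpM2l th0 hFx; have := ler_wpM2l (addr_ge0 ler01 th0) hE.
lra.
Qed.

(** [newton_error] is divided by [d = - fd t]: the slope term satisfies [q * D <= fd s - fd t <= d],
    and [K < d] gives [2 * theta <= 2 * theta / K * d]. *)
Lemma newton_error_kappa x y z t s : F z = 0 -> `|x - x0| <= t -> `|z - x| <= s - t ->
  t < s -> s < L ->
  `|Ainv (F x + 'd F x (y - x))| <= theta * `|Ainv (F x)| ->
  `|z - y| <= ((1 + theta) / 2 + 2 * theta / K) * `|z - x|.
Proof.
move=> Fz xt zst ts sL hr; have /andP[th0 _] := hth.
have sR := lt_le_trans sL lambda_le_radius.
have t0 : 0 <= t by exact: le_trans xt.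
have K0 := kappa_gt0.
have /andP[dK _] : K < - fd t <= 1.
  by apply: fd_neg_le1; rewrite t0 (lt_trans ts sL).
have fs : fd s < - K by apply: fd_lt_lambda; rewrite sL (le_trans t0 (ltW ts)).
have := newton_error Fz xt zst ts sR th0 hr.
set D := `|z - x| in zst *; set q := _ / (s - t); set d := - fd t in dK *.
have D0 : 0 <= D := normr_ge0 _.
have q0 : 0 <= q by rewrite divr_ge0 ?subr_ge0 ?fd_mono// ltW.
have qst : q * (s - t) = fd s - fd t by rewrite divfK// gt_eqF// subr_gt0.
have qD : q * D <= d by have := ler_wpM2l q0 zst; rewrite qst /d; lra.
have a1 : (1 + theta) / 2 * (q * D * D) <= (1 + theta) / 2 * (d * D).
  by rewrite ler_wpM2l ?divr_ge0 ?addr_ge0// ler_wpM2r.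
have a2 : 2 * theta <= 2 * theta / K * d.
  by rewrite mulrAC ler_pdivlMr// ler_wpM2l ?mulr_ge0// ltW.
have a3 : 2 * theta * D <= 2 * theta / K * d * D by rewrite ler_wpM2r.
have a4 : 0 <= theta * d * D by rewrite !mulr_ge0//; lra.
move=> h; rewrite -(ler_pM2l (lt_trans K0 dK)).
rewrite -/d in h; rewrite (_ : 2 + fd t = 2 - d) in h; last by rewrite /d opprK.
lra.
Qed.

(** In [newton_error] the data at [t] are moved to [lambda]: [fd t <= fd L < 0], and the slope is at
    most [Dminus fd L]. *)
Lemma newton_error_lambda x y z t s : F z = 0 -> `|x - x0| <= t ->
  `|z - x| <= s - t -> t < s -> s < L -> L < Rr ->
  `|Ainv (F x + 'd F x (y - x))| <= theta * `|Ainv (F x)| ->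
  `|z - y| <= ((1 + theta) / 2 * (Dminus fd L / `|fd L|) * `|z - x|
    + theta * ((2 + fd L) / `|fd L|)) * `|z - x|.
Proof.
move=> Fz xt zst ts sL LR hr; have /andP[th0 _] := hth.
have sR := lt_le_trans sL lambda_le_radius.
have t0 : 0 <= t by exact: le_trans xt.
have K0 := kappa_gt0.
have L0 : 0 < L by apply: le_lt_trans t0 (lt_trans ts sL).
have fL := fd_lambda L0 LR.
have ftL : fd t <= fd L by rewrite fd_mono// ltW// (lt_trans ts).
have -> : `|fd L| = - fd L by rewrite ltr0_norm//; lra.
have := newton_error Fz xt zst ts sR th0 hr.
have := slope_le_Dminus t0 ts sL LR.
set D := `|z - x| in zst *; set q := _ / (s - t); set m := Dminus _ _.
move=> qm h; have D0 : 0 <= D := normr_ge0 _.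
have b0 : 0 < - fd L by lra.
have -> : ((1 + theta) / 2 * (m / - fd L) * D + theta * ((2 + fd L) / - fd L)) * D =
    ((1 + theta) / 2 * m * D ^+ 2 + theta * (2 + fd L) * D) / - fd L.
  by field; rewrite lt_eqF//; lra.
rewrite ler_pdivlMr//.
have a1 : (1 + theta) / 2 * q * D ^+ 2 <= (1 + theta) / 2 * m * D ^+ 2.
  by rewrite ler_wpM2r ?sqr_ge0// ler_wpM2l// divr_ge0// addr_ge0.
have a2 : theta * (2 + fd t) * D <= theta * (2 + fd L) * D.
  by rewrite ler_wpM2r// ler_wpM2l// lerD2l.
have a3 : - fd L * `|z - y| <= - fd t * `|z - y| by rewrite ler_wpM2r// lerN2.
lra.
Qed.

(** * Convergence of the inexact Newton sequence *)

Section Iteration.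
Variables (t0 e0 : R) (y0 : X).
Hypothesis hOm0 : Omega f fd Rr (t0, e0).
Hypothesis hy0 : Kset F Ainv x0 f t0 e0 y0.
Local Notation te k := (iter k (n_theta f fd theta) (t0, e0)).
Local Notation y k := (iter k N y0).

Lemma newton_iter k : Kset F Ainv x0 f (te k).1 (te k).2 (y k) /\
  `|y k.+1 - y k| <= (te k.+1).1 - (te k).1.
Proof.
have step j : Kset F Ainv x0 f (te j).1 (te j).2 (y j) ->
    `|y j.+1 - y j| <= (te j.+1).1 - (te j).1 /\
    Kset F Ainv x0 f (te j.+1).1 (te j.+1).2 (y j.+1).
  have := Omega_iter hth hOm0 j; rewrite !(iterS j); case: (te j) => a b.
  by move=> Oab; exact: newton_step.
have inv : Kset F Ainv x0 f (te k).1 (te k).2 (y k).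
  by elim: k => [//|k /step[]].
by split => //; have [] := step k inv.
Qed.

(** Some residual is below [K * (u - tt)], hence so is [f] at that [t_k], as [e_k] is nonnegative;
    from there to [u] the slope of [f] is below [- K]. *)
Lemma f_lt0_above_limit tt u : (forall k, (te k).1 <= tt) -> tt < u -> u < L -> f u < 0.
Proof.
move=> tle ttu uL; have K0 := kappa_gt0.
have Ku : 0 < K * (u - tt) by rewrite mulr_gt0// subr_gt0.
have /cvgrPdist_lt/(_ _ Ku)[k _ /(_ k (leqnn k))] := residual_iter_cvg hth hOm0.
rewrite /= sub0r normrN => pk.
have [/andP[tk0 _] [/andP[ek0 _] _]] := Omega_iter hth hOm0 k.
have tku := le_lt_trans (tle k) ttu.
have := f_lt_tangent tk0 tku (lt_le_trans uL lambda_le_radius).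
have := @fd_lt_lambda u; rewrite uL (le_trans tk0 (ltW tku)) => /(_ isT) fu.
have : fd u * (u - (te k).1) <= - K * (u - (te k).1).
  by rewrite ler_wpM2r ?subr_ge0 ?ltW.
have : K * (u - tt) <= K * (u - (te k).1) by rewrite ler_wpM2l ?(ltW K0)// lerD2l lerN2.
by have := ler_norm (f (te k).1 + (te k).2); lra.
Qed.

Lemma newton_iter_cvg : exists tt ee xs,
  [/\ (fun k => (te k).1) @ \oo --> tt, 0 < tt < L /\ forall k, (te k).1 < tt,
      (fun k => (te k).2) @ \oo --> ee, 0 <= ee <= K * L &
  [/\ (fun k => y k) @ \oo --> xs,
      `|xs - x0| <= tstar f Rr,
      `|xs - x0| < taubar f Rr /\ F xs = 0,
      (forall z, `|z - x0| < taubar f Rr -> F z = 0 -> z = xs) &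
      (forall k, `|xs - y k| <= tt - (te k).1)]].
Proof.
have K0 := kappa_gt0.
have [b bL tb] := t_iter_bounded hth hOm0.
have tS k := t_iter_lt hth hOm0 k.
have [tt tcvg [ttb tle]] := nondecreasing_bounded_cvg (fun k => ltW (tS k)) tb.
have ttL := le_lt_trans ttb bL.
have tlt k : (te k).1 < tt := lt_le_trans (tS k) (tle k.+1).
have Oj k := Omega_iter hth hOm0 k.
have [|ee ecvg [eeb ele]] :=
  @nondecreasing_bounded_cvg R (fun k => (te k).2) (K * L) (e_iter_le hth hOm0).
  move=> k; have [/andP[_ tL] [/andP[_ eK] _]] := Oj k.
  by apply: le_trans eK _; rewrite ler_wpM2l ?ltW.
have [xs ycvg yxs] := majorized_cvg (fun k => (newton_iter k).2) tcvg.
have xstt : `|xs - x0| <= tt.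
  have := yxs 0%N; have [/=] := hy0.
  by have := ler_normD (xs - y0) (y0 - x0); rewrite subrKA; lra.
have LR := lambda_le_radius.
have xsR : `|xs - x0| < Rr by apply: le_lt_trans xstt (lt_le_trans ttL LR).
have Fxs : F xs = 0.
  by apply: limit_zero xsR ycvg _ (residual_iter_cvg hth hOm0) => k; case: (newton_iter k) => -[].
have [l [xs' [lR fl lmin xs'l [Fxs' uniq_zero]]]] := zero_exists_unique.
(* A radius with [f u < 0] whose closed ball contains [xs]: uniqueness identifies [xs] with the zero
   [xs'] found near [x0]. *)
pose u := (tt + L) / 2.
have ttu : tt < u by rewrite /u; lra.
have uL : u < L by rewrite /u; lra.
have fu := f_lt0_above_limit tle ttu uL.
have xsE := uniq_zero xs u (lt_le_trans uL LR) fu (le_trans xstt (ltW ttu)) Fxs.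
have tt0 : 0 < tt.
  by apply: le_lt_trans (tlt 0%N); have [/andP[]] := Oj 0%N.
have supR : has_sup [set t | 0 <= t < Rr /\ f t < 0].
  split; last by exists Rr => t [/andP[_ /ltW]].
  by have [t [/andP[tp tR] ft]] := h3; exists t; rewrite /= ltW.
exists tt, ee, xs; split => //.
- by rewrite tt0.
- by rewrite eeb andbT; apply: le_trans (ele 0%N); have [_ [/andP[]]] := Oj 0%N.
split => //.
- rewrite xsE; apply: le_trans xs'l _; apply: lb_le_inf.
    by case/andP: lR => l0 lR; exists l; rewrite /= ltW.
  by move=> t [tR ft]; apply: lmin => //; rewrite ft.
- have u0 := lt_trans tt0 ttu; split => //.
  apply: le_lt_trans xstt _; apply: lt_le_trans ttu _.
  apply: ub_le_sup; first by case: supR.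
  by split => //; rewrite (lt_le_trans uL LR) ltW.
- move=> z zt Fz; rewrite xsE.
  (* As [z] lies strictly inside the ball of radius [taubar], some closed ball of radius [c] with
     [f c < 0] contains it. *)
  have [c [/andP[_ cR] fc]] := sup_adherent (eps := taubar f Rr - `|z - x0|)
    ltac:(by rewrite subr_gt0) supR.
  rewrite -/(taubar f Rr) subKr => zc.
  exact: (uniq_zero z c cR fc (ltW zc) Fz).
Qed.

End Iteration.
End InexactStep.
End Newton.
End Majorant.

Unset Implicit Arguments.

Theorem theorem5p1 (R : realType) (X Y : completeNormedModType R)
  (Rr : R) (C : set X) (F : X -> Y) (x0 : X) (Ainv : Y -> X)
  (f fd : R -> R) (theta : R) (N : X -> X) (t0 e0 : R) (y0 : X)
  (* F continuous on C, continuously (Frechet) differentiable on int(C) *)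
  (hFc : {within C, continuous F})
  (hFd : forall x, interior C x -> differentiable F x)
  (hFdc : forall x, interior C x -> forall eps, 0 < eps ->
     exists2 d, 0 < d & forall z, interior C z -> `|z - x| < d ->
       forall v, `|'d F z v - 'd F x v| <= eps * `|v|)
  (hx0 : interior C x0)
  (* F'(x0) non-singular, with (bounded) inverse Ainv = F'(x0)^{-1} *)
  (hA1 : forall v, Ainv ('d F x0 v) = v)
  (hA2 : forall w, 'd F x0 (Ainv w) = w)
  (hAc : continuous Ainv)
  (* f continuously differentiable on [0,R) with derivative fd *)
  (hfd : forall t, 0 < t < Rr -> is_derive t 1 f (fd t))
  (hfd0 : (fun h => (f h - f 0) / h) @ 0^'+ --> fd 0)
  (hfdc : {within `[0, Rr[, continuous fd})
  (hBC : forall x, `|x - x0| < Rr -> C x)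
  (hmaj : forall x y, `|x - x0| < Rr -> `|y - x0| < Rr ->
     `|x - x0| + `|y - x| < Rr ->
     forall v, `|Ainv ('d F y v - 'd F x v)|
        <= (fd (`|y - x| + `|x - x0|) - fd `|x - x0|) * `|v|)
  (hF0 : `|Ainv (F x0)| <= f 0)
  (* (h1) *)
  (h1a : 0 < f 0) (h1b : fd 0 = -1)
  (* (h2) *)
  (h2inc : forall a b, 0 <= a -> a < b -> b < Rr -> fd a < fd b)
  (h2cvx : forall a b s, 0 <= a < Rr -> 0 <= b < Rr -> 0 <= s <= 1 ->
     fd (s * a + (1 - s) * b) <= s * fd a + (1 - s) * fd b)
  (* (h3) *)
  (h3 : exists t, 0 < t < Rr /\ f t < 0)
  (* 0 <= theta <= Theta, N in the family N_theta *)
  (hth : 0 <= theta <= Theta f Rr)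
  (hN : forall x, `|x - x0| < tbar fd Rr ->
     `|Ainv (F x + 'd F x (N x - x))| <= theta * `|Ainv (F x)|)
  (* initial data *)
  (hOm0 : Omega f fd Rr (t0, e0))
  (hy0 : Kset F Ainv x0 f t0 e0 y0) :
  let y := fun k : nat => iter k N y0 in
  let t := fun k : nat => (iter k (n_theta f fd theta) (t0, e0)).1 in
  let e := fun k : nat => (iter k (n_theta f fd theta) (t0, e0)).2 in
  let lam := lambda f fd Rr in
  let kap := kappa f Rr in
  (* well-definedness and invariance *)
  (forall k, t k < tbar fd Rr /\ 0 <= e k /\ `|y k - x0| < tbar fd Rr) /\
  (forall k, Kset F Ainv x0 f (t k) (e k) (y k) /\ Omega f fd Rr (t k, e k)) /\
  (forall k, t k < t k.+1) /\
  (forall k, e k <= e k.+1) /\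
  (forall k, `|Ainv (F (y k))| <= f (t k) + e k /\
             f (t k) + e k <= ((1 + theta ^+ 2) / 2) ^+ k * (f t0 + e0)) /\
  (forall k, `|y k - x0| < lam) /\
  exists tt ee xs,
    [/\ t @ \oo --> tt, 0 < tt <= lam, e @ \oo --> ee, 0 <= ee <= kap * lam &
    [/\ y @ \oo --> xs,
        `|xs - x0| <= tstar f Rr,
        `|xs - x0| < taubar f Rr /\ F xs = 0,
        (forall z, `|z - x0| < taubar f Rr -> F z = 0 -> z = xs) &
    [/\ (forall k, `|y k.+1 - y k| <= t k.+1 - t k),
        (forall k, `|xs - y k| <= tt - t k),
        (lam < Rr -> forall k,
           `|xs - y k.+1| <=
             ((1 + theta) / 2 * (Dminus fd lam / `|fd lam|) * `|xs - y k|
              + theta * ((2 + fd lam) / `|fd lam|)) * `|xs - y k|) &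
        (lam < Rr -> 0 <= theta < kap / (4 + kap) -> forall k,
           `|xs - y k.+1| <= ((1 + theta) / 2 + 2 * theta / kap) * `|xs - y k|)]]].
Proof.
have hOm k := Omega_iter hfd hfd0 h1a h1b h2inc h3 hth hOm0 k.
have hK k := newton_iter hfd hfd0 h1a h1b h2inc h2cvx h3 hFd hA1 hA2 hAc hBC hmaj
  hth hN hOm0 hy0 k.
have Llt := lambda_le_tbar hfd hfd0 h1a h1b h2inc h3.
have [tt [ee [xs [tcvg [ttL tlt] ecvg eeb [ycvg xs_tstar xs_taubar uniq_xs yxs]]]]] :=
  newton_iter_cvg hfd hfd0 h1a h1b h2inc h2cvx h3 hFd hA1 hA2 hAc hBC hmaj hF0
  hth hN hOm0 hy0.
move=> y t e lam kap.
have tL k : t k < lam by have [/andP[]] := hOm k.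
have yt k : `|y k - x0| <= t k by have [[]] := hK k.
have yL k : `|y k - x0| < lam := le_lt_trans (yt k) (tL k).
(* The iterates stay within [lambda], hence in the ball of radius [tbar] where [hN] applies. *)
have hr k : `|Ainv (F (y k) + 'd F (y k) (y k.+1 - y k))| <= theta * `|Ainv (F (y k))|.
  by rewrite /y iterS; apply: hN; exact: lt_le_trans (yL k) Llt.
have ttlam : tt < lam by case/andP: ttL.
have Fxs : F xs = 0 by case: xs_taubar.
split; [|split; [|split; [|split; [|split; [|split]]]]] => //.
- move=> k; split; first exact: lt_le_trans (tL k) Llt.
  split; last exact: lt_le_trans (yL k) Llt.
  by have [_ [/andP[]]] := hOm k.
- move=> k; split; first by case: (hK k).
  by rewrite /t /e; have := hOm k; case: (iter k _ _).
- by move=> k; exact: t_iter_lt.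
- by move=> k; exact: e_iter_le.
- move=> k; split; first by have [[]] := hK k.
  exact: residual_iter_le.
exists tt, ee, xs; split => //; first by case/andP: ttL => -> /ltW.
split => //; split => //.
- by move=> k; case: (hK k).
(* Both error estimates take the limit [tt] as outer radius [s], which requires [tt < lam] to be
   strict. *)
- move=> LR k; exact: (newton_error_lambda hfd hfd0 h1a h1b h2inc h2cvx h3 hFd hA1 hA2
    hAc hBC hmaj hth Fxs (yt k) (yxs k) (tlt k) ttlam LR (hr k)).
- move=> _ _ k; exact: (newton_error_kappa hfd hfd0 h1a h1b h2inc h2cvx h3 hFd hA1 hA2
    hAc hBC hmaj hth Fxs (yt k) (yxs k) (tlt k) ttlam (hr k)).
Qed.
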